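(* Let $n\ge 3$ be an integer, $r>0$ and $\varepsilon\in[0,1)$. Then the map $\mathcal T_n:\mathbb S^2(r)\to\mathbb K_n(r,\varepsilon)$ (defined in the context) is a continuous bijection from the sphere $\mathbb S^2(r)$ onto the polyhedral surface $\mathbb K_n(r,\varepsilon)$, and it is area preserving: $\mathcal A(D)=\mathcal A(\mathcal T_n(D))$ for all domains $D\subseteq\mathbb S^2(r)$, where $\mathcal A$ denotes surface area. Moreover, the inverse is given as follows. Let $(X,Y,Z)\in\mathbb K_n(r,\varepsilon)$ and let $i\in\{0,\dots,n-1\}$ be such that $(X,Y)$ has a polar angle in $[\alpha_i,\alpha_{i+1}]$. Then $(x,y,z)=\mathcal T_n^{-1}(X,Y,Z)$ satisfies: (a) if $(X,Y,Z)\in\mathbb P_n^+$, then $z=r-r(1-\varepsilon)\left(1-\frac{Z-\varepsilon r}{b_n}\right)^2$; if $(X,Y,Z)\in\mathbb P_n^-$, then $z=r(1-\varepsilon)\left(1-\frac{|Z|-\varepsilon r}{b_n}\right)^2-r$; and in both cases $$x=\sqrt{r^2-z^2}\,\cos(\lambda+\alpha_i),\quad y=\sqrt{r^2-z^2}\,\sin(\lambda+\alpha_i),\quad \lambda=\frac{\pi}{n\sin\frac{\pi}{n}}\cdot\frac{-X\sin\alpha_i+Y\cos\alpha_i}{X\cos(\alpha_i+\frac{\pi}{n})+Y\sin(\alpha_i+\frac{\pi}{n})}$$ (at the apexes, where $X=Y=0$, one has $x=y=0$); (b) if $(X,Y,Z)\in\mathbb B_n$, then $z=Z$ and $$x=\sqrt{r^2-Z^2}\,\cos(\mu+\alpha_i),\quad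 y=\sqrt{r^2-Z^2}\,\sin(\mu+\alpha_i),\quad \mu=\frac{Y\cos\alpha_i-X\sin\alpha_i}{r\cos\frac{\pi}{n}}.$$
   Context: $\mathbb S^2(r)$ is the sphere of radius $r$ centered at the origin $O$ of $\mathbb R^3$. Notation: $\alpha_i=\frac{2\pi i}{n}$, $R_n=\frac{\pi r}{n\sin(\pi/n)}$. The polyhedron $\mathbb K_n(r,\varepsilon)$ (regarded as a surface) is formed by the lateral surface $\mathbb B_n$ of a regular prism and the lateral surfaces $\mathbb P_n^+$, $\mathbb P_n^-$ of two congruent pyramids. The prism has height $2\varepsilon r$, is centered at $O$ and symmetric with respect to the plane $z=0$, and its bases are regular $n$-gons of edge $\frac{2\pi r}{n}$ (circumscribed radius $R_n$) in the planes $z=\pm\varepsilon r$, with vertices $(R_n\cos\alpha_i,R_n\sin\alpha_i,\pm\varepsilon r)$, $i=0,\dots,n-1$. The bases of the two pyramids coincide with the two bases of the prism, $\mathbb P_n^+$ above and $\mathbb P_n^-$ below, and each pyramid has lateral area $2\pi(1-\varepsilon)r^2$. Hence the slant height of each pyramid is $2(1-\varepsilon)r$, its altitude is $$b_n=r\left(4(1-\varepsilon)^2-\frac{\pi^2}{n^2}\cot^2\frac{\pi}{n}\right)^{1/2},$$ and the apexes are $(0,0,\pm(\varepsilon r+b_n))$. When $\varepsilon=0$ the prism degenerates to a polygon. The map $\mathcal T_n$: for $(x,y,z)\in\mathbb S^2(r)$ let $\theta\in[0,2\pi)$ be the longitude, $(x,y)=\sqrt{r^2-z^2}\,(\cos\theta,\sin\theta)$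 ($\theta$ is arbitrary at the poles), let $i\in\{0,\dots,n-1\}$ be such that $\alpha_i\le\theta<\alpha_{i+1}$, and put $$w(\theta)=\left(\frac{\pi\cos\alpha_i}{n\sin\frac{\pi}{n}}-\sin\left(\alpha_i+\tfrac{\pi}{n}\right)(\theta-\alpha_i),\ \frac{\pi\sin\alpha_i}{n\sin\frac{\pi}{n}}+\cos\left(\alpha_i+\tfrac{\pi}{n}\right)(\theta-\alpha_i)\right)\in\mathbb R^2.$$ Then $(X,Y,Z)=\mathcal T_n(x,y,z)$ is defined by: - if $z\ge\varepsilon r$: $(X,Y)=\sqrt{\frac{r(r-z)}{1-\varepsilon}}\;w(\theta)$, $Z=\varepsilon r+b_n\left(1-\sqrt{\frac{1-z/r}{1-\varepsilon}}\right)$; - if $|z|\le\varepsilon r$: $(X,Y)=r\,w(\theta)$, $Z=z$; - if $z\le-\varepsilon r$: $(X,Y)=\sqrt{\frac{r(r+z)}{1-\varepsilon}}\;w(\theta)$, $Z=-\varepsilon r-b_n\left(1-\sqrt{\frac{1+z/r}{1-\varepsilon}}\right)$.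
   Formalization: It is assumed in addition that 4(1−ε)² > (π²/n²)cot²(π/n), i.e. that b_n is a positive real; for other ε in [0,1), e.g. n=3, ε=0.8, b_n is imaginary (or zero, and the inverse formula divides by zero), so the pyramids or formulas are undefined. *)

(* Defs.v *)
From HB Require Import structures.
From mathcomp Require Export all_boot all_order all_algebra.
From mathcomp Require Export all_classical all_reals all_analysis.
Set Implicit Arguments.
Unset Strict Implicit.
Unset Printing Implicit Defensive.
Export Order.TTheory GRing.Theory Num.Theory numFieldNormedType.Exports.
Local Open Scope classical_set_scope.
Local Open Scope ring_scope.

(* Points of R^3 are nested pairs ((x, y), z) : R * R * R, with the product
   topology (that of R^3) and the product sigma-algebra (the Borel sets of
   R^3). *)

Definition cot (R : realType) (x : R) : R := cos x / sin x.

(** * Surface area *)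

Record patch (R : realType) := Patch {
  patch_dom : set (R * R);
  patch_map : R * R -> R * R * R }.

Definition patch_set (R : realType) (S : patch R) : set (R * R * R) :=
  patch_map S @` patch_dom S.

Definition cross_norm (R : realType) (a b : R * R * R) : R :=
  Num.sqrt ((a.1.2 * b.2 - a.2 * b.1.2) ^+ 2
          + (a.2 * b.1.1 - a.1.1 * b.2) ^+ 2
          + (a.1.1 * b.1.2 - a.1.2 * b.1.1) ^+ 2).

Definition area_density (R : realType) (Phi : R * R -> R * R * R)
    (p : R * R) : R :=
  cross_norm ('D_((1, 0) : R * R) Phi p) ('D_((0, 1) : R * R) Phi p).

(* The area of D in the surface made of the patches s, which may overlap only
   along sets of parameters of measure zero: the integral of
   |Phi_u x Phi_v| du dv over the parameters (u, v) of the points of D, summed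
   over the patches. *)
Definition surface_area (R : realType) (s : seq (patch R))
    (D : set (R * R * R)) : \bar R :=
  (\sum_(S <- s)
     \int[(@lebesgue_measure R) \x (@lebesgue_measure R)]_(p in
         patch_dom S `&` patch_map S @^-1` D)
       (area_density (patch_map S) p)%:E)%E.

(** * The sphere *)

Definition sphere (R : realType) (r : R) : set (R * R * R) :=
  [set q | q.1.1 ^+ 2 + q.1.2 ^+ 2 + q.2 ^+ 2 = r ^+ 2].

(* The sphere parametrized by longitude and colatitude. *)
Definition sphere_patch (R : realType) (r : R) : patch R :=
  Patch [set p | 0 <= p.1 < 2 * pi /\ 0 <= p.2 <= pi]
        (fun p => (r * cos p.1 * sin p.2, r * sin p.1 * sin p.2, r * cos p.2)).

Definition sphere_area (R : realType) (r : R) (D : set (R * R * R)) : \bar R :=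
  surface_area [:: sphere_patch r] D.

(** * The polyhedral surface *)

Definition affine_map (R : realType) (A B C : R * R * R) (p : R * R) :
    R * R * R :=
  A + p.1 *: (B - A) + p.2 *: (C - A).

Definition triangle (R : realType) (A B C : R * R * R) : patch R :=
  Patch [set p | [/\ 0 <= p.1, 0 <= p.2 & p.1 + p.2 <= 1]]
        (affine_map A B C).

(* The parallelogram with vertices A, B, B + C - A, C. *)
Definition parallelogram (R : realType) (A B C : R * R * R) : patch R :=
  Patch [set p | 0 <= p.1 <= 1 /\ 0 <= p.2 <= 1] (affine_map A B C).

Definition alpha (R : realType) (n i : nat) : R := 2 * pi * i%:R / n%:R.

Definition circumradius (R : realType) (n : nat) (r : R) : R :=
  pi * r / (n%:R * sin (pi / n%:R)).

Definition vertex (R : realType) (n : nat) (r h : R) (i : nat) : R * R * R :=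
  (circumradius n r * cos (alpha R n i),
   circumradius n r * sin (alpha R n i), h).

(* (b_n / r)^2, where b_n is the altitude of the pyramids; the pyramids exist
   exactly when it is positive, i.e. when the slant height 2 (1 - eps) r
   exceeds the apothem (pi r / n) cot (pi / n) of the base. *)
Definition altitude_radicand (R : realType) (n : nat) (eps : R) : R :=
  4 * (1 - eps) ^+ 2 - pi ^+ 2 / n%:R ^+ 2 * cot (pi / n%:R) ^+ 2.

Definition altitude (R : realType) (n : nat) (r eps : R) : R :=
  r * Num.sqrt (altitude_radicand n eps).

(* When eps = 0 these are the edges of the polygon, as patches of area 0. *)
Definition prism_faces (R : realType) (n : nat) (r eps : R) : seq (patch R) :=
  [seq parallelogram (vertex n r (- (eps * r)) i) (vertex n r (- (eps * r)) i.+1)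
                     (vertex n r (eps * r) i) | i <- iota 0 n].

(* Base in the plane z = h, apex (0, 0, a). *)
Definition pyramid_faces (R : realType) (n : nat) (r h a : R) : seq (patch R) :=
  [seq triangle (vertex n r h i) (vertex n r h i.+1) (0, 0, a) | i <- iota 0 n].

Definition upper_faces (R : realType) (n : nat) (r eps : R) : seq (patch R) :=
  pyramid_faces n r (eps * r) (eps * r + altitude n r eps).

Definition lower_faces (R : realType) (n : nat) (r eps : R) : seq (patch R) :=
  pyramid_faces n r (- (eps * r)) (- (eps * r + altitude n r eps)).

Definition faces_union (R : realType) (s : seq (patch R)) : set (R * R * R) :=
  \big[setU/set0]_(S <- s) patch_set S.

Definition prism (R : realType) (n : nat) (r eps : R) : set (R * R * R) :=
  faces_union (prism_faces n r eps).

Definition upper_pyramid (R : realType) (n : nat) (r eps : R) :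
    set (R * R * R) :=
  faces_union (upper_faces n r eps).

Definition lower_pyramid (R : realType) (n : nat) (r eps : R) :
    set (R * R * R) :=
  faces_union (lower_faces n r eps).

Definition polyhedron (R : realType) (n : nat) (r eps : R) : set (R * R * R) :=
  prism n r eps `|` upper_pyramid n r eps `|` lower_pyramid n r eps.

Definition polyhedron_area (R : realType) (n : nat) (r eps : R)
    (D : set (R * R * R)) : \bar R :=
  surface_area (prism_faces n r eps ++ upper_faces n r eps
                ++ lower_faces n r eps) D.

(** * The map from the sphere to the polyhedral surface *)

(* At the poles every angle of [0, 2 pi) satisfies the condition, and xget
   returns an unspecified one. *)
Definition longitude (R : realType) (r : R) (q : R * R * R) : R :=
  xget 0 [set t : R | 0 <= t < 2 * pi /\
    q.1 = Num.sqrt (r ^+ 2 - q.2 ^+ 2) *: ((cos t, sin t) : R * R)].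

Definition sector (R : realType) (n : nat) (t : R) : nat :=
  xget 0%N [set i : nat | (i < n)%N /\ alpha R n i <= t < alpha R n i.+1].

Definition w_map (R : realType) (n : nat) (t : R) : R * R :=
  let a := alpha R n (sector n t) in
  (pi * cos a / (n%:R * sin (pi / n%:R)) - sin (a + pi / n%:R) * (t - a),
   pi * sin a / (n%:R * sin (pi / n%:R)) + cos (a + pi / n%:R) * (t - a)).

(* The three clauses agree where they overlap, on z = eps r and z = - eps r. *)
Definition T_map (R : realType) (n : nat) (r eps : R) (q : R * R * R) :
    R * R * R :=
  let z := q.2 in
  let w := w_map n (longitude r q) in
  let b := altitude n r eps in
  if eps * r <= z then
    (Num.sqrt (r * (r - z) / (1 - eps)) *: w,
     eps * r + b * (1 - Num.sqrt ((1 - z / r) / (1 - eps))))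
  else if `|z| <= eps * r then (r *: w, z)
  else
    (Num.sqrt (r * (r + z) / (1 - eps)) *: w,
     - (eps * r) - b * (1 - Num.sqrt ((1 + z / r) / (1 - eps)))).

Definition polar_angle (R : realType) (X Y t : R) : Prop :=
  exists rho : R, [/\ 0 <= rho, X = rho * cos t & Y = rho * sin t].

(* Main.v *)
(* In the coordinates (t, z) = (longitude, height) of the sphere, T_n maps the
   sector [alpha_i, alpha_(i+1)] x [-r, r] to the union of the three faces over
   the i-th edge, by the explicit map face_pt: the horizontal section at height
   z is a scaled edge, run through at constant speed in t.  Neighbouring sectors
   share a ray on which their formulas agree, so any sector containing the polar
   angle of a point (X, Y) may be used to invert T_n; this gives the formulas for
   the inverse and the injectivity.  The preimage of a closed set is a finite
   union of continuous images of compact sets of coordinates, whence continuity.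

   The area on the sphere is r dt dz (Archimedes).  On a face, with its affine
   parameters (u, v), the coordinates are t = alpha_i + (2 pi / n) u / s(v) and
   z = F(v), where s(v) is the relative length of the section at v; Tonelli's
   theorem and two one-dimensional changes of variables show that the constant
   area density of the face also becomes r dt dz. *)
From HB Require Import structures.
Require Import Defs.
From mathcomp Require Import all_boot all_order all_algebra.
From mathcomp Require Import all_classical all_reals all_analysis.
From mathcomp Require Import measurable_realfun.
From mathcomp Require Import ring lra.
Import Order.TTheory GRing.Theory Num.Theory numFieldNormedType.Exports.
Set Implicit Arguments.
Unset Strict Implicit.
Unset Printing Implicit Defensive.
Local Open Scope classical_set_scope.
Local Open Scope ring_scope.

(** * Sectors and the map w *)

(** The three clauses of [T_map] and its half-open sectors are traded for formulas on closed ranges: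
    [cap_scale] is cut off at 1, so [radius] and [height] are single continuous functions of z, and
    [height] is odd, so the lower pyramid mirrors the upper one. The price is overlap: on a sector
    boundary, at longitude 0 = 2 pi and at the poles a point has several coordinates, and the
    agreement of the formulas there is settled once, in [T_map_sphere_pt]. The constants fit for two
    reasons. With h = pi / n, the chord 2 (h / sin h) sin h has length 2 h, the angular width of a
    sector; and the slant height is 2 (1 - eps) r. On a triangle the density is 2 h r times 2 (1 -
    eps) r; the section at v has length s = 1 - v in u, so du = s dt / (2 h), while z = r - r (1 -
    eps) s ^ 2 gives dz = 2 r (1 - eps) s dv. The product is r dt dz. Since D is only assumed
    measurable, the substitutions are stated as equalities of finite measures and checked on
    generating half-lines and rectangles. *)

Lemma cos_sin_inj (R : realType) (s t : R) :
  0 <= s <= 2 * pi -> 0 <= t <= 2 * pi -> cos s = cos t -> sin s = sin t ->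
  [\/ s = t, s = 0 /\ t = 2 * pi | s = 2 * pi /\ t = 0].
Proof.
wlog : s t / t <= s => [hw|ts] hs ht hc hsn.
  have [/hw|/ltW/hw] := leP t s; first exact.
  by case/(_ ht hs (esym hc) (esym hsn)) => [->|[-> ->]|[-> ->]];
    [constructor 1|constructor 3|constructor 2].
(* A difference in [0, 2 pi] with cosine 1 is 0 or 2 pi: the injectivity of cosine on [0, pi] is
   applied to s - t or to 2 pi - (s - t). The value 2 pi is the wrap-around, possible because both
   angles range over a closed interval. *)
have c1 : cos (s - t) = 1 by rewrite cosB hc hsn -!expr2 cos2Dsin2.
have [dpi|/ltW dpi] := leP (s - t) pi.
  constructor 1; apply/eqP; rewrite -subr_eq0; apply/eqP.
  apply: cos_inj; rewrite ?in_itv/= ?lexx ?pi_ge0 ?cos0 ?subr_ge0 ?ts//.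
have : 2 * pi - (s - t) = 0.
  apply: cos_inj; rewrite ?in_itv/= ?lexx ?pi_ge0 ?cos0//.
    by apply/andP; split; lra.
  have -> : 2 * pi - (s - t) = - (s - t) + pi *+ 2 by ring.
  by rewrite cosD2pi cosN.
by move=> e; constructor 3; split; lra.
Qed.

Lemma cos_sin_surj (R : realType) (x y : R) : x ^+ 2 + y ^+ 2 = 1 ->
  exists2 t : R, 0 <= t < 2 * pi & x = cos t /\ y = sin t.
Proof.
move=> xy1.
have x1 : -1 <= x <= 1.
  rewrite -ler_norml -(ler_pXn2r (_ : (0 < 2)%N)) ?nnegrE//.
  by rewrite real_normK ?num_real// expr1n -xy1 lerDl sqr_ge0.
have ca : cos (acos x) = x by apply: acosK; rewrite in_itv.
have sa : sin (acos x) = `|y|.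
  by rewrite sin_acos// -sqrtr_sqr; congr Num.sqrt; rewrite -xy1; ring.
have a0 := acos_ge0 x1; have api := acos_lepi x1; have p0 := pi_gt0 R.
(* [acos] covers the upper half circle, and the lower one is its reflection. For y < 0 the angle
   stays strictly below 2 pi, because [acos x = 0] would force y = 0. *)
have [y0|y0] := leP 0 y.
  by exists (acos x); [lra|rewrite ca sa ger0_norm].
exists (2 * pi - acos x).
  apply/andP; split; first lra.
  suff a_neq0 : acos x != 0 by have : 0 < acos x;
    [rewrite lt_neqAle eq_sym a_neq0|lra].
  apply/eqP => h; move: sa; rewrite h sin0 => /esym/eqP.
  by rewrite normr_eq0 => /eqP y00; move: y0; rewrite y00 ltxx.
have -> : 2 * pi - acos x = - acos x + pi *+ 2 by ring.
by rewrite cosD2pi sinD2pi cosN sinN ca sa ltr0_norm// opprK.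
Qed.

Section Sectors.
Variables (R : realType) (n : nat).
Hypothesis hn : (3 <= n)%N.
Local Notation al := (alpha R n).
Local Notation h := (pi / n%:R : R).

Let n0 : 0 < n%:R :> R.
Proof. by rewrite ltr0n; apply: leq_trans hn. Qed.

Let n_neq0 : n%:R != 0 :> R.
Proof. by rewrite gt_eqF. Qed.

Lemma half_angle_gt0 : 0 < h.
Proof. by rewrite divr_gt0 ?pi_gt0. Qed.

Lemma half_angle_lt : h < pi / 2.
Proof.
rewrite ltr_pM2l ?pi_gt0// ltf_pV2 ?posrE//.
by rewrite (ltr_nat R 2 n).
Qed.

Lemma sin_half_gt0 : 0 < sin h.
Proof.
apply: sin_gt0_pihalf; by rewrite half_angle_gt0 half_angle_lt.
Qed.

Lemma cos_half_gt0 : 0 < cos h.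
Proof.
apply: cos_gt0_pihalf; rewrite half_angle_lt andbT.
by have := half_angle_gt0; have := pi_gt0 R; lra.
Qed.

Lemma alpha0 : al 0 = 0.
Proof. by rewrite /alpha mulr0 mul0r. Qed.

Lemma alphan : al n = 2 * pi.
Proof. by rewrite /alpha mulfK. Qed.

Lemma alphaS i : al i.+1 = al i + 2 * h.
Proof. by rewrite /alpha -natr1; field. Qed.

Lemma ler_alpha i j : (i <= j)%N -> al i <= al j.
Proof.
move=> ij; rewrite /alpha ler_pM2r ?invr_gt0//.
by rewrite ler_wpM2l ?ler_nat// mulr_ge0// pi_ge0.
Qed.

Lemma ltr_alpha i j : (al i < al j) = (i < j)%N.
Proof.
rewrite /alpha ltr_pM2r ?invr_gt0// ltr_pM2l ?ltr_nat//.
by rewrite mulr_gt0// pi_gt0.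
Qed.

Lemma alpha_bounds i t : (i < n)%N -> al i <= t <= al i.+1 -> 0 <= t <= 2 * pi.
Proof.
move=> ltin /andP[it ti]; rewrite -alphan -alpha0.
by rewrite (le_trans _ it) ?ler_alpha// (le_trans ti)// ler_alpha.
Qed.

Lemma sector_exists t : 0 <= t < 2 * pi ->
  exists2 i, (i < n)%N & al i <= t < al i.+1.
Proof.
rewrite -alphan => /andP[t0].
suff H m : (m <= n)%N -> t < al m -> exists2 i, (i < n)%N & al i <= t < al i.+1.
  exact: H.
elim: m => [|m IH] mn.
  by rewrite alpha0 => /(le_lt_trans t0); rewrite ltxx.
have [mt tm|tm _] := leP (al m) t; first by exists m => //; rewrite mt.
by apply: IH => //; apply: ltnW.
Qed.

Lemma sector_unique i j t :
  al i <= t < al i.+1 -> al j <= t < al j.+1 -> i = j.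
Proof.
move=> /andP[i1 i2] /andP[j1 j2]; apply/eqP; rewrite eqn_leq.
rewrite -ltnS -[X in _ && X]ltnS.
by rewrite -!ltr_alpha (le_lt_trans i1 j2) (le_lt_trans j1 i2).
Qed.

Lemma sectorE i t : (i < n)%N -> al i <= t < al i.+1 -> sector n t = i.
Proof.
move=> ltin it; rewrite /sector; case: xgetP => [j _ [_ jt]|/(_ i)].
  exact: sector_unique jt it.
by case.
Qed.

(* The point w(theta), computed with the formula of the sector i. *)
Definition w_face (i : nat) (t : R) : R * R :=
  let a := al i in
  (pi * cos a / (n%:R * sin h) - sin (a + h) * (t - a),
   pi * sin a / (n%:R * sin h) + cos (a + h) * (t - a)).

Local Notation rho := (h / sin h).

Let sh_neq0 : sin h != 0.
Proof. by rewrite gt_eqF ?sin_half_gt0. Qed.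

Let ch_neq0 : cos h != 0.
Proof. by rewrite gt_eqF ?cos_half_gt0. Qed.

Let h_neq0 : h != 0.
Proof. by rewrite gt_eqF ?half_angle_gt0. Qed.

(* Coordinates relative to the foot of the perpendicular from the centre to
   the edge, which is at the polar angle of the middle of the sector. *)
Lemma w_face_foot i t : let b := al i + h in
  w_face i t = (rho * cos h * cos b - (t - b) * sin b,
                rho * cos h * sin b + (t - b) * cos b).
Proof.
move=> b; rewrite /w_face -/b.
have -> : al i = b - h by rewrite /b; ring.
rewrite cosB sinB; congr (_, _); field; by rewrite n_neq0 sh_neq0.
Qed.

(** The chord between two consecutive vertices at distance [rho] has length 2 [rho] sin h = 2 h,
    exactly the range of t in the sector; so unit speed in t is affine motion from vertex to
    vertex. *)
Lemma w_face_convex i u : w_face i (al i + 2 * h * u) =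
  (rho * ((1 - u) * cos (al i) + u * cos (al i.+1)),
   rho * ((1 - u) * sin (al i) + u * sin (al i.+1))).
Proof.
rewrite w_face_foot alphaS.
set b := al i + h.
have -> : al i + 2 * h = b + h by rewrite /b; ring.
have -> : al i = b - h by rewrite /b; ring.
rewrite cosB sinB cosD sinD; congr (_, _); field; by rewrite n_neq0 sh_neq0.
Qed.

Lemma w_face_next i : w_face i (al i.+1) = w_face i.+1 (al i.+1).
Proof.
have -> : w_face i (al i.+1) = w_face i (al i + 2 * h * 1).
  by rewrite mulr1 alphaS.
have -> : w_face i.+1 (al i.+1) = w_face i.+1 (al i.+1 + 2 * h * 0).
  by rewrite mulr0 addr0.
by rewrite !w_face_convex !subr0 !subrr !mul0r !mul1r !add0r !addr0.
Qed.

Lemma w_face_wrap : w_face n.-1 (2 * pi) = w_face 0 0.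
Proof.
have nn : n.-1.+1 = n by rewrite prednK// (leq_trans _ hn).
have -> : w_face n.-1 (2 * pi) = w_face n (al n).
  by have := w_face_next n.-1; rewrite nn alphan.
rewrite /w_face alphan alpha0 !subrr !mulr0.
have -> : 2 * pi = 0 + pi *+ 2 :> R by ring.
by rewrite cosD2pi sinD2pi.
Qed.

(** The edge is traversed at unit speed, in a direction at angle h to the normal of the first vertex
    direction, and starts at that vertex. Up to the factor [radius], this is the numerator of [lam]
    and [mu]. *)
Lemma w_face_cross i t : let w := w_face i t in
  w.2 * cos (al i) - w.1 * sin (al i) = (t - al i) * cos h.
Proof.
rewrite w_face_foot/=; set b := al i + h.
have -> : al i = b - h by rewrite /b; ring.
rewrite cosB sinB.
transitivity ((rho * cos h * sin h + (t - b) * cos h) *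
  (cos b ^+ 2 + sin b ^+ 2)); first by ring.
by rewrite cos2Dsin2; field; rewrite n_neq0 sh_neq0.
Qed.

(** The edge lies on the line with normal direction [al i + h] at distance [rho * cos h], the
    apothem. Up to the factor [radius] this is the denominator of [lam]; its positivity keeps the
    edge away from the origin. *)
Lemma w_face_dot i t : let w := w_face i t in
  w.1 * cos (al i + h) + w.2 * sin (al i + h) = rho * cos h.
Proof.
rewrite w_face_foot/=; set b := al i + h.
transitivity (rho * cos h * (cos b ^+ 2 + sin b ^+ 2)); first by ring.
by rewrite cos2Dsin2 mulr1.
Qed.

Lemma rho_gt0 : 0 < rho.
Proof. by rewrite divr_gt0 ?half_angle_gt0 ?sin_half_gt0. Qed.

Lemma rho_cos_gt0 : 0 < rho * cos h.
Proof. by rewrite mulr_gt0 ?rho_gt0 ?cos_half_gt0. Qed.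

Lemma w_face_neq0 i t : w_face i t <> (0, 0).
Proof.
move=> e; have := w_face_dot i t; rewrite e/= !mul0r addr0.
by move/esym/eqP; rewrite gt_eqF ?rho_cos_gt0.
Qed.

(** The polar angle of [w_face i t], in general different from t: the right triangle at the foot of
    the perpendicular has as legs the apothem and the offset [t - (al i + h)]. *)
Definition w_angle (i : nat) (t : R) : R :=
  al i + h + atan ((t - (al i + h)) / (rho * cos h)).

Lemma w_face_angle i t : exists2 k : R, 0 < k &
  w_face i t = (k * cos (w_angle i t), k * sin (w_angle i t)).
Proof.
rewrite w_face_foot /w_angle; set b := al i + h; set d := rho * cos h.
have d0 : 0 < d by exact: rho_cos_gt0.
set x := (t - b) / d.
have tb : t - b = x * d by rewrite /x divfK ?gt_eqF.
have c0 : 0 < cos (atan x).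
  by rewrite cos_gt0_pihalf// atan_gtNpi2 atan_ltpi2.
have sx : sin (atan x) = x * cos (atan x).
  by rewrite -{2}(atanK x) /tan divfK ?gt_eqF.
exists (d / cos (atan x)); first by rewrite divr_gt0.
by rewrite cosD sinD sx tb; congr (_, _); field; rewrite gt_eqF.
Qed.

Let tan_half_quotient (x s c : R) : x != 0 -> s != 0 -> c != 0 ->
  x / (x / s * c) = s / c.
Proof. by move=> *; field; apply/and3P. Qed.

Lemma w_angle_left i : w_angle i (al i) = al i.
Proof.
rewrite /w_angle.
have -> : (al i - (al i + h)) / (rho * cos h) = - tan h.
  by rewrite /tan -(tan_half_quotient h_neq0 sh_neq0 ch_neq0); ring.
rewrite atanN tanK; first by ring.
by rewrite in_itv/= half_angle_lt andbT (@lt_trans _ _ 0) ?half_angle_gt0//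
  oppr_lt0 divr_gt0 ?pi_gt0.
Qed.

Lemma w_angle_right i : w_angle i (al i.+1) = al i.+1.
Proof.
rewrite /w_angle alphaS.
have -> : (al i + 2 * h - (al i + h)) / (rho * cos h) = tan h.
  by rewrite /tan -(tan_half_quotient h_neq0 sh_neq0 ch_neq0); ring.
rewrite tanK; first by ring.
by rewrite in_itv/= half_angle_lt andbT (@lt_trans _ _ 0) ?half_angle_gt0//
  oppr_lt0 divr_gt0 ?pi_gt0.
Qed.

Lemma le_w_angle i : {mono w_angle i : s t / s <= t}.
Proof.
apply: le_mono => s t st; rewrite /w_angle ltrD2l; apply: lt_atan.
by rewrite ltr_pM2r ?invr_gt0 ?rho_cos_gt0// ltrD2r.
Qed.

Lemma w_angle_inj i : injective (w_angle i).
Proof. exact: (inc_inj (le_w_angle i)). Qed.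

Lemma w_angle_bounds i t : al i <= t <= al i.+1 ->
  al i <= w_angle i t <= al i.+1.
Proof.
move=> it; rewrite -{1}(w_angle_left i) -[X in _ && (_ <= X)](w_angle_right i).
by rewrite !le_w_angle.
Qed.

(* Two sectors share at most a ray, on which their formulas agree: so the
   parameter of a point of an edge may be moved to any sector containing the
   point. *)
Lemma w_face_change i j t k th :
  (i < n)%N -> (j < n)%N -> al j <= t <= al j.+1 ->
  al i <= th <= al i.+1 -> 0 < k -> w_face j t = (k * cos th, k * sin th) ->
  exists2 t', al i <= t' <= al i.+1 &
    [/\ cos t' = cos t, sin t' = sin t & w_face i t' = w_face j t].
Proof.
move=> ltin ltjn jt ith k0 wk.
have [k' k'0 wk'] := w_face_angle j t.
have jw := w_angle_bounds jt; set ph := w_angle j t in wk' jw.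
have [ec es] : k * cos th = k' * cos ph /\ k * sin th = k' * sin ph.
  by move: wk; rewrite wk' => -[-> ->].
(* Both are the distance of the same point from the origin. *)
have kk : k = k'.
  apply/eqP; rewrite -(eqrXn2 (_ : (0 < 2)%N)) ?ltW//; apply/eqP.
  rewrite -[LHS]mulr1 -(cos2Dsin2 th) -[RHS]mulr1 -(cos2Dsin2 ph) !mulrDr.
  by rewrite -!exprMn ec es.
have {}ec : cos th = cos ph.
  by move: ec; rewrite kk; apply: mulfI; rewrite gt_eqF.
have {}es : sin th = sin ph.
  by move: es; rewrite kk; apply: mulfI; rewrite gt_eqF.
(* [w_angle] is injective and fixes both ends of the sector, so a polar angle on a boundary ray puts
   the parameter t itself at that end. *)
have left_end l : l = w_angle j t -> l = al j -> t = al j.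
  by move=> -> e; apply: (@w_angle_inj j); rewrite w_angle_left.
have right_end l : l = w_angle j t -> l = al j.+1 -> t = al j.+1.
  by move=> -> e; apply: (@w_angle_inj j); rewrite w_angle_right.
have ibd : al i <= al i <= al i.+1 by rewrite lexx ler_alpha.
have ibd' : al i <= al i.+1 <= al i.+1 by rewrite lexx ler_alpha.
(* If the angles are equal, the sectors coincide or are neighbours sharing a vertex. In the other
   two cases one angle is 0 and the other 2 pi, so the sectors are the first and the last, joined by
   [w_face_wrap]. *)
have [e|[e1 e2]|[e1 e2]] :=
    cos_sin_inj (alpha_bounds ltin ith) (alpha_bounds ltjn jw) ec es.
- rewrite e in ith.
  have [ij|ji|ij] := ltngtP i j; last by exists t; rewrite ij.
    have jE : j = i.+1.
      apply/eqP; rewrite eqn_leq ij andbT leqNgt -ltr_alpha -leNgt.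
      by move: ith jw => /andP[_ p] /andP[q _]; exact: le_trans p.
    have tE : t = al j.
      apply: (left_end ph) => //; apply: le_anti; case/andP: jw => -> _.
      by case/andP: ith => _; rewrite -jE andbT.
    by exists (al i.+1) => //; rewrite tE jE; split=> //; exact: w_face_next.
  have iE : i = j.+1.
    apply/eqP; rewrite eqn_leq ji andbT leqNgt -ltr_alpha -leNgt.
    by move: ith jw => /andP[p _] /andP[_ q]; exact: le_trans q.
  have tE : t = al j.+1.
    apply: (right_end ph) => //; apply: le_anti; case/andP: jw => _ ->.
    by case/andP: ith; rewrite iE.
  by exists (al i) => //; rewrite tE iE; split=> //; rewrite w_face_next.
- have i0 : i = 0%N.
    move: ith; rewrite e1 -alpha0 => /andP[+ _].
    by rewrite leNgt ltr_alpha -leqNgt leqn0 => /eqP.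
  have jn : j.+1 = n.
    apply/eqP; rewrite eqn_leq ltjn leqNgt -ltr_alpha -leNgt alphan -e2.
    by case/andP: jw.
  have tE : t = al j.+1 by apply: (right_end ph); rewrite // jn alphan.
  exists (al i) => //; rewrite tE jn i0 alphan alpha0.
  have p2 : 2 * pi = 0 + pi *+ 2 :> R by ring.
  by rewrite -w_face_wrap -jn {1 2}p2 cosD2pi sinD2pi.
- have iE : i.+1 = n.
    apply/eqP; rewrite eqn_leq ltin leqNgt -ltr_alpha -leNgt alphan -e1.
    by case/andP: ith.
  have j0 : j = 0%N.
    move: jw; rewrite e2 -alpha0 => /andP[+ _].
    by rewrite leNgt ltr_alpha -leqNgt leqn0 => /eqP.
  have tE : t = al j by apply: (left_end ph); rewrite // j0 alpha0.
  exists (al i.+1) => //; rewrite tE iE j0 alphan alpha0.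
  have p2 : 2 * pi = 0 + pi *+ 2 :> R by ring.
  by rewrite {1 2}p2 cosD2pi sinD2pi -w_face_wrap -iE.
Qed.

End Sectors.

(** * The map in the coordinates p = (longitude, height) *)

Definition sphere_pt (R : realType) (r : R) (p : R * R) : R * R * R :=
  (Num.sqrt (r ^+ 2 - p.2 ^+ 2) * cos p.1,
   Num.sqrt (r ^+ 2 - p.2 ^+ 2) * sin p.1, p.2).

Section SphereCoordinates.
Variables (R : realType) (r : R).
Hypothesis hr : 0 < r.

Let bound_sqr (z : R) : - r <= z <= r -> 0 <= r ^+ 2 - z ^+ 2.
Proof. by move=> /andP[? ?]; rewrite subr_sqr mulr_ge0//; lra. Qed.

Let bound_sqr_gt (z : R) : - r < z < r -> 0 < r ^+ 2 - z ^+ 2.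
Proof. by move=> /andP[? ?]; rewrite subr_sqr mulr_gt0//; lra. Qed.

Lemma sphere_sphere_pt p : - r <= p.2 <= r -> sphere r (sphere_pt r p).
Proof.
move=> /bound_sqr pz; rewrite /sphere/= !exprMn sqr_sqrtr// -mulrDr cos2Dsin2.
by rewrite mulr1 subrK.
Qed.

Lemma sphere_bounds q : sphere r q -> - r <= q.2 <= r.
Proof.
rewrite /sphere/= => e; rewrite -ler_norml.
rewrite -(ler_pXn2r (_ : (0 < 2)%N)) ?nnegrE ?(ltW hr)//.
by rewrite real_normK ?num_real// -e lerDr addr_ge0// sqr_ge0.
Qed.

Lemma sphere_longitude q : sphere r q ->
  exists2 t : R, 0 <= t < 2 * pi & q = sphere_pt r (t, q.2).
Proof.
move=> Sq; have qz := sphere_bounds Sq; have s0 := bound_sqr qz.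
have e : q.1.1 ^+ 2 + q.1.2 ^+ 2 = r ^+ 2 - q.2 ^+ 2.
  by rewrite -(Sq : _ = r ^+ 2); ring.
have [s00|sn0] := eqVneq (r ^+ 2 - q.2 ^+ 2) 0.
  exists 0; first by rewrite lexx mulr_gt0 ?pi_gt0.
  move: e; rewrite /sphere_pt/= s00 sqrtr0 !mul0r => /eqP.
  rewrite paddr_eq0 ?sqr_ge0// !sqrf_eq0 => /andP[/eqP e1 /eqP e2].
  by move: e1 e2; case: (q) => -[/= x y] z -> ->.
set s := Num.sqrt (r ^+ 2 - q.2 ^+ 2).
have sgt : 0 < s by rewrite sqrtr_gt0 lt_neqAle eq_sym sn0.
have [|t tb [cx sy]] := @cos_sin_surj _ (q.1.1 / s) (q.1.2 / s).
  by rewrite !expr_div_n -mulrDl e sqr_sqrtr// divff.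
exists t => //; rewrite /sphere_pt/= -/s -cx -sy ![s * _]mulrC !divfK ?gt_eqF//.
by case: (q) => -[].
Qed.

(** Strict bounds on z exclude the poles, where [longitude] is unspecified. Elsewhere the parallel
    has positive radius, so cosine and sine are determined, and the half-open range rules out the
    wrap-around. *)
Lemma longitudeE t z : 0 <= t < 2 * pi -> - r < z < r ->
  longitude r (sphere_pt r (t, z)) = t.
Proof.
move=> tb zb; have s0 := bound_sqr_gt zb.
rewrite /longitude; case: xgetP => [t' _ /= [t'b e]|/(_ t)]; last by case.
have sn : Num.sqrt (r ^+ 2 - z ^+ 2) != 0 by rewrite gt_eqF ?sqrtr_gt0.
case: e => /(mulfI sn) ec /(mulfI sn) es.
have tb' : 0 <= t <= 2 * pi by case/andP: tb => -> /ltW.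
have t'b' : 0 <= t' <= 2 * pi by case/andP: t'b => -> /ltW.
have [//|[_ e]|[e _]] := cos_sin_inj tb' t'b' ec es.
- by move: t'b; rewrite e ltxx andbF.
- by move: tb; rewrite e ltxx andbF.
Qed.

Lemma sphere_pt_pole p : p.2 = r \/ p.2 = - r -> sphere_pt r p = (0, 0, p.2).
Proof.
move=> h; have -> : p = (p.1, p.2) by case: (p).
by case: h => ->; rewrite /sphere_pt/= ?sqrrN subrr sqrtr0 !mul0r.
Qed.

Lemma sphere_bounds_cases z : - r <= z <= r ->
  - r < z < r \/ (z = r \/ z = - r).
Proof.
move=> /andP[]; rewrite !le_eqVlt => /orP[/eqP <-|->]; first by right; right.
by move=> /orP[/eqP ->|->]; [right; left|left].
Qed.

End SphereCoordinates.

Section Map.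
Variables (R : realType) (n : nat) (r eps : R).
Hypotheses (hn : (3 <= n)%N) (hr : 0 < r) (heps : 0 <= eps < 1).
Hypothesis hpyr : 0 < altitude_radicand n eps.
Local Notation al := (alpha R n).
Local Notation b := (altitude n r eps).

(** The size of the horizontal section relative to the base of the upper pyramid. The minimum with 1
    extends it by the constant 1 below the cap; evaluated at - z it serves the lower pyramid. *)
Definition cap_scale (z : R) : R :=
  Num.sqrt (Num.min 1 ((1 - z / r) / (1 - eps))).

(* One of the two scales is always 1. *)
Definition radius (z : R) : R := r * cap_scale z * cap_scale (- z).

(** The clamp of z to the range of the prism, plus a rise over each base. In each of the three zones
    of z only one of the three terms varies. *)
Definition height (z : R) : R :=
  Num.max (- (eps * r)) (Num.min (eps * r) z) +
  b * (1 - cap_scale z) - b * (1 - cap_scale (- z)).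

Definition face_pt (i : nat) (p : R * R) : R * R * R :=
  (radius p.2 *: w_face n i p.1, height p.2).

Let eps0 : 0 <= eps. Proof. by case/andP: heps. Qed.
Let eps1 : 0 < 1 - eps. Proof. by rewrite subr_gt0; case/andP: heps. Qed.
Let er0 : 0 <= eps * r. Proof. by rewrite mulr_ge0// ltW. Qed.

Lemma altitude_gt0 : 0 < b.
Proof. by rewrite /altitude mulr_gt0// sqrtr_gt0. Qed.

Lemma cap_scale_below z : z <= eps * r -> cap_scale z = 1.
Proof.
move=> zle; rewrite /cap_scale min_l ?sqrtr1//.
rewrite ler_pdivlMr// mul1r lerD2l lerN2 ler_pdivrMr//.
Qed.

Lemma cap_scale_above z : eps * r <= z ->
  cap_scale z = Num.sqrt ((1 - z / r) / (1 - eps)).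
Proof.
move=> zge; rewrite /cap_scale min_r//.
by rewrite ler_pdivrMr// mul1r lerD2l lerN2 ler_pdivlMr.
Qed.

Lemma cap_scale_ge0 z : 0 <= cap_scale z.
Proof. exact: sqrtr_ge0. Qed.

Lemma cap_scale_le1 z : cap_scale z <= 1.
Proof. by rewrite -[leRHS]sqrtr1 ler_sqrt// ge_min lexx. Qed.

Lemma cap_scale_lt1 z : eps * r < z -> cap_scale z < 1.
Proof.
move=> zge; rewrite cap_scale_above ?ltW// -[ltRHS]sqrtr1 ltr_sqrt//.
by rewrite ltr_pdivrMr// mul1r ltrD2l ltrN2 ltr_pdivlMr.
Qed.

Lemma cap_scale_gt0 z : z < r -> 0 < cap_scale z.
Proof.
move=> zr; rewrite sqrtr_gt0 lt_min ltr01 divr_gt0// subr_gt0 ltr_pdivrMr//.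
by rewrite mul1r.
Qed.

Lemma cap_scale_top : cap_scale r = 0.
Proof.
rewrite cap_scale_above ?divff ?gt_eqF// ?subrr ?mul0r ?sqrtr0//.
by rewrite ler_piMl ?ltW//; case/andP: heps.
Qed.

Lemma radiusN z : radius (- z) = radius z.
Proof. by rewrite /radius opprK mulrAC. Qed.

(** The clamp is odd and the two cap terms are exchanged. This is what reduces the lower pyramid to
    the upper one. *)
Lemma heightN z : height (- z) = - height z.
Proof.
rewrite /height opprK.
have -> : Num.max (- (eps * r)) (Num.min (eps * r) (- z)) =
          - Num.max (- (eps * r)) (Num.min (eps * r) z).
  move: er0; move: (eps * r) => c c0.
  have [h1|h1] := leP z (- c).
    by rewrite min_l ?[Num.min c z]min_r ?[Num.max _ z]max_l ?max_r ?opprK//; lra.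
  have [h2|h2] := leP c z.
    by rewrite [Num.min c (- z)]min_r ?[Num.max _ (- z)]max_l ?[Num.max _ c]max_r//; lra.
  by rewrite [Num.min c (- z)]min_r ?[Num.max _ z]max_r
    ?[Num.max _ (- z)]max_r//; lra.
ring.
Qed.

Lemma radius_mid z : - (eps * r) <= z <= eps * r -> radius z = r.
Proof.
move=> /andP[z1 z2]; rewrite /radius !cap_scale_below ?mulr1//; lra.
Qed.

Lemma height_mid z : - (eps * r) <= z <= eps * r -> height z = z.
Proof.
move=> /andP[z1 z2]; rewrite /height !cap_scale_below//; last lra.
by rewrite min_r// max_r// subrr mulr0 addr0 subr0.
Qed.

Lemma radius_top z : eps * r <= z -> radius z = r * cap_scale z.
Proof.
by move=> z1; rewrite /radius [cap_scale (- z)]cap_scale_below ?mulr1//; have := er0; lra.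
Qed.

Lemma height_top z : eps * r <= z ->
  height z = eps * r + b * (1 - cap_scale z).
Proof.
have := er0; move=> c0 z1; rewrite /height [cap_scale (- z)]cap_scale_below; last by lra.
by rewrite min_l// max_r ?subrr ?mulr0 ?subr0//; lra.
Qed.

Lemma radius_ge0 z : 0 <= radius z.
Proof. by rewrite /radius !mulr_ge0 ?cap_scale_ge0// ltW. Qed.

Lemma radius_gt0 z : - r < z < r -> 0 < radius z.
Proof.
by move=> /andP[? ?]; rewrite /radius !mulr_gt0 ?cap_scale_gt0//; lra.
Qed.

Lemma radius_pole z : z = r \/ z = - r -> radius z = 0.
Proof. by case=> ->; rewrite /radius ?opprK cap_scale_top ?mulr0 ?mul0r. Qed.

(** The zones are not mixed: below [eps * r], [height] is either the identity or, by oddness, less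
    than [- (eps * r)]. With its mirror [height_le], this lets the zone of z be read off from Z. *)
Lemma height_ge z : (eps * r <= height z) = (eps * r <= z).
Proof.
have b0 := altitude_gt0; have sz := cap_scale_le1 z.
apply/idP/idP => [hz|zge]; last by rewrite height_top// lerDl mulr_ge0 ?subr_ge0// ltW.
rewrite leNgt; apply/negP => zlt.
have [zge|zlt'] := leP (- (eps * r)) z.
  have hm : height z = z by apply: height_mid; lra.
  by rewrite hm in hz; lra.
move: hz; rewrite -[z]opprK heightN height_top; last by lra.
have : 0 < b * (1 - cap_scale (- z)).
  by rewrite mulr_gt0// subr_gt0 cap_scale_lt1//; lra.
move=> ? ?; have := er0; lra.
Qed.

Lemma height_le z : (height z <= - (eps * r)) = (z <= - (eps * r)).
Proof. by rewrite lerNr -heightN height_ge lerNr. Qed.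

(** A closed form exists because [1 - (height z - eps * r) / b] is [cap_scale z], whose square is
    affine in z on the cap. *)
Lemma height_top_inv z : eps * r <= z <= r ->
  z = r - r * (1 - eps) * (1 - (height z - eps * r) / b) ^+ 2.
Proof.
move=> /andP[z1 z2]; have b0 := altitude_gt0.
rewrite height_top//.
have -> : 1 - (eps * r + b * (1 - cap_scale z) - eps * r) / b = cap_scale z.
  by field; rewrite gt_eqF.
rewrite cap_scale_above// sqr_sqrtr; first by field; rewrite !gt_eqF.
by rewrite divr_ge0 ?(ltW eps1)// subr_ge0 ler_pdivrMr// mul1r.
Qed.

Lemma height_inj y z : - r <= y <= r -> - r <= z <= r ->
  height y = height z -> y = z.
Proof.
move=> yb zb e.
have [yge|ylt] := leP (eps * r) y.
  have zge : eps * r <= z by rewrite -height_ge -e height_ge.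
  rewrite (height_top_inv (_ : _ <= y <= r)) ?e ?yge; last by case/andP: yb.
  by rewrite -height_top_inv// zge; case/andP: zb.
have zlt : z < eps * r by rewrite ltNge -height_ge -e height_ge -ltNge.
have [yle|ygt] := leP y (- (eps * r)).
  have zle : z <= - (eps * r) by rewrite -height_le -e height_le.
  apply: oppr_inj; rewrite (height_top_inv (_ : _ <= - y <= r)); last by lra.
  by rewrite heightN e -heightN -height_top_inv//; lra.
have zgt : - (eps * r) < z by rewrite ltNge -height_le -e height_le -ltNge.
by move: e; rewrite !height_mid//; rewrite !ltW.
Qed.

Lemma T_mapE q : T_map n r eps q =
  (radius q.2 *: w_map n (longitude r q), height q.2).
Proof.
(* Taking r ^ 2 out of the root turns the scaling factor of [T_map] into r times the quantity under
   [cap_scale]. *)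
have sq (x : R) : Num.sqrt (r * (r - x) / (1 - eps)) =
    r * Num.sqrt ((1 - x / r) / (1 - eps)).
  rewrite -[X in _ = X * _](ger0_norm (ltW hr)) -sqrtr_sqr -sqrtrM ?sqr_ge0//.
  by congr Num.sqrt; field; rewrite !gt_eqF.
rewrite /T_map; case: leP => [z1|z1].
  by rewrite radius_top// height_top// cap_scale_above// sq.
case: ifPn => z2.
  by rewrite ler_norml in z2; rewrite radius_mid ?height_mid.
have z3 : eps * r <= - q.2.
  by rewrite leNgt; apply: contra z2 => h; rewrite ler_norml; apply/andP; split; lra.
rewrite -radiusN -[X in height X]opprK heightN radius_top// height_top//.
rewrite cap_scale_above// -sq mulNr !opprK; congr (_, _).
by ring.
Qed.

(** [w_map] works with half-open sectors, while t may be the right end of its closed sector. There u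
    lies in the next sector, or is 0 after a full turn, and both formulas give the common vertex. *)
Lemma w_mapE i t u : (i < n)%N -> al i <= t <= al i.+1 -> 0 <= u < 2 * pi ->
  cos u = cos t -> sin u = sin t -> w_map n u = w_face n i t.
Proof.
move=> ltin it ub ec es; have tb := alpha_bounds hn ltin it.
have [j ltjn ju] := sector_exists hn ub.
rewrite /w_map (sectorE hn ltjn ju) -/(w_face n j u).
have ub' : 0 <= u <= 2 * pi by case/andP: ub => -> /ltW.
have [e|[e1 e2]|[e1 e2]] := cos_sin_inj ub' tb ec es.
- have [tlt|tge] := ltP t (al i.+1).
    have it' : al i <= t < al i.+1 by case/andP: it => ->.
    by rewrite e in ju *; rewrite (sector_unique hn it' ju).
  have tE : t = al i.+1 by apply: le_anti; rewrite tge; case/andP: it => _ ->.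
  have jE : j = i.+1.
    apply: (sector_unique hn ju); rewrite e tE lexx /=.
    by rewrite (ltr_alpha R hn).
  by rewrite e tE jE w_face_next.
- have j0 : j = 0%N.
    move: ju; rewrite e1 -(alpha0 R n) => /andP[+ _].
    by rewrite leNgt (ltr_alpha R hn) -leqNgt leqn0 => /eqP.
  have iE : i.+1 = n.
    apply/eqP; rewrite eqn_leq ltin leqNgt -(ltr_alpha R hn) -leNgt (alphan R hn) -e2.
    by case/andP: it.
  by rewrite e1 e2 j0 -(w_face_wrap R hn) -iE.
- by move: ub; rewrite e1 ltxx andbF.
Qed.

Lemma T_map_sphere_pt i t z : (i < n)%N -> al i <= t <= al i.+1 ->
  - r <= z <= r -> T_map n r eps (sphere_pt r (t, z)) = face_pt i (t, z).
Proof.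
move=> ltin it zb; rewrite T_mapE /face_pt/=.
(* At a pole the longitude is unspecified, but [radius] vanishes, so the value of [w_map] has no
   effect. *)
have [zb'|zp] := sphere_bounds_cases zb; last by rewrite radius_pole// !scale0r.
have [u ub e] := sphere_longitude hr (sphere_sphere_pt (zb : - r <= (t, z).2 <= r)).
rewrite e longitudeE//; congr (_ *: _, _); apply: w_mapE => //.
all: have sn : Num.sqrt (r ^+ 2 - z ^+ 2) != 0 by
  rewrite gt_eqF// sqrtr_gt0 subr_sqr mulr_gt0//; move: zb' => /andP[]; lra.
all: by case: e => /(mulfI sn) ec /(mulfI sn) es.
Qed.

Lemma sphere_param q : sphere r q ->
  exists i t, [/\ (i < n)%N, al i <= t <= al i.+1, - r <= q.2 <= r &
                  q = sphere_pt r (t, q.2)].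
Proof.
move=> Sq; have [t tb e] := sphere_longitude hr Sq.
have [i ltin /andP[it /ltW ti]] := sector_exists hn tb.
by exists i, t; split; rewrite ?it//; exact: sphere_bounds.
Qed.

Lemma T_map_param q X Y Z i : sphere r q -> (i < n)%N ->
  (exists2 t : R, al i <= t <= al i.+1 & polar_angle X Y t) ->
  T_map n r eps q = (X, Y, Z) ->
  exists t, [/\ al i <= t <= al i.+1, - r <= q.2 <= r,
    q = sphere_pt r (t, q.2) & (X, Y, Z) = face_pt i (t, q.2)].
Proof.
move=> Sq ltin [th ith [rho [rho0 Xe Ye]]] Tq.
have [j [t [ltjn jt zb qE]]] := sphere_param Sq.
have [zb'|zp] := sphere_bounds_cases zb; last first.
  (* At a pole every longitude describes q, so the left end of the prescribed sector will do. *)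
  have ii : al i <= al i <= al i.+1 by rewrite lexx ler_alpha.
  have qp : q = sphere_pt r (al i, q.2) by rewrite qE !sphere_pt_pole.
  by exists (al i); split=> //; rewrite -Tq {1}qp (T_map_sphere_pt ltin ii zb).
have rg := radius_gt0 zb'.
have e : face_pt j (t, q.2) = (X, Y, Z) by rewrite -(T_map_sphere_pt ltjn jt zb) -qE.
case wE : (w_face n j t) => [w1 w2].
have [eX eY eZ] : [/\ radius q.2 * w1 = X, radius q.2 * w2 = Y & height q.2 = Z].
  by move: e; rewrite /face_pt [w_face _ _ _]wE/=; case.
have [t' it' [ec es ew]] : exists2 t', al i <= t' <= al i.+1 &
    [/\ cos t' = cos t, sin t' = sin t & w_face n i t' = w_face n j t].
  (* [rho / radius q.2] is the polar distance of the unscaled edge point; it is nonzero because the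
     edge avoids the origin. *)
  apply: (@w_face_change R n hn i j t (rho / radius q.2) th) => //.
    rewrite divr_gt0// lt_neqAle rho0 andbT; apply/eqP => rho00.
    apply: (@w_face_neq0 R n hn j t); rewrite wE.
    have rgn : radius q.2 != 0 by rewrite gt_eqF.
    congr (_, _); apply: (mulfI rgn).
      by rewrite eX Xe -rho00 mul0r mulr0.
    by rewrite eY Ye -rho00 mul0r mulr0.
  by rewrite wE mulrAC -Xe mulrAC -Ye -eX -eY ![radius _ * _]mulrC !mulfK ?gt_eqF.
exists t'; split=> //; first by rewrite [LHS]qE /sphere_pt/= ec es.
by rewrite -e /face_pt/= ew.
Qed.

(** The third coordinate determines the height; then the cross product with the vertex direction,
    affine in the longitude with nonzero slope, determines the longitude. At a pole t and u may
    differ, hence a conclusion about points of the sphere. *)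
Lemma face_pt_inj i t u y z : - r <= y <= r -> - r <= z <= r ->
  face_pt i (t, y) = face_pt i (u, z) -> sphere_pt r (t, y) = sphere_pt r (u, z).
Proof.
move=> yb zb e; have [eX eY eZ] := e.
have yz := height_inj yb zb eZ; rewrite -yz in eX eY zb *.
have [yb'|yp] := sphere_bounds_cases yb; last by rewrite !sphere_pt_pole.
have rg : radius y != 0 by rewrite gt_eqF ?radius_gt0.
have c0 : cos (pi / n%:R) != 0 :> R by rewrite gt_eqF ?cos_half_gt0.
have := w_face_cross hn i t; rewrite /= (mulfI rg eX) (mulfI rg eY).
by rewrite (w_face_cross hn i u) => /(mulIf c0)/addIr ->.
Qed.

Lemma face_pt_polar i t z : al i <= t <= al i.+1 ->
  exists2 u, al i <= u <= al i.+1 &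
    polar_angle (face_pt i (t, z)).1.1 (face_pt i (t, z)).1.2 u.
Proof.
move=> it; exists (w_angle n i t); first exact: w_angle_bounds.
have [k k0 wk] := w_face_angle hn i t; exists (radius z * k).
by split; [exact: mulr_ge0 (radius_ge0 _) (ltW k0)|
  rewrite /face_pt [w_face _ _ _]wk/= -mulrA..].
Qed.

(** The sector of p contains the polar angle of the common image, so [T_map_param] describes q in
    that same sector, where [face_pt_inj] applies. *)
Lemma T_map_inj p q : sphere r p -> sphere r q ->
  T_map n r eps p = T_map n r eps q -> p = q.
Proof.
move=> Sp Sq e; have [i [t [ltin it zb pE]]] := sphere_param Sp.
have Tp : T_map n r eps p = face_pt i (t, p.2) by rewrite pE (T_map_sphere_pt ltin it zb).
have pol := face_pt_polar p.2 it.
have [|u [iu qb qE fE]] :=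
  @T_map_param q _ _ (face_pt i (t, p.2)).2 i Sq ltin pol.
  by rewrite -e Tp -surjective_pairing.
rewrite pE qE; exact: (@face_pt_inj i).
Qed.

End Map.

(** * The faces and the inverse map *)

Lemma faces_unionP (R : realType) (m : nat) (f : nat -> Defs.patch R) q :
  faces_union [seq f i | i <- iota 0 m] q <->
  exists2 i, (i < m)%N & patch_set (f i) q.
Proof.
rewrite /faces_union big_map -bigcup_seq; split.
  by case=> i /=; rewrite mem_iota add0n => /andP[_ im] fq; exists i.
by case=> i im fq; exists i => //=; rewrite mem_iota add0n.
Qed.

Lemma affine_mapE (R : realType) (A B C : R * R * R) p : affine_map A B C p =
  (A.1.1 + p.1 * (B.1.1 - A.1.1) + p.2 * (C.1.1 - A.1.1),
   A.1.2 + p.1 * (B.1.2 - A.1.2) + p.2 * (C.1.2 - A.1.2),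
   A.2 + p.1 * (B.2 - A.2) + p.2 * (C.2 - A.2)).
Proof. by move: A B C => [[? ?] ?] [[? ?] ?] [[? ?] ?]. Qed.

Lemma scale_pairE (R : realType) (k x y : R) :
  k *: ((x, y) : R * R) = (k * x, k * y).
Proof. by []. Qed.

Section Faces.
Variables (R : realType) (n : nat) (r eps : R).
Hypotheses (hn : (3 <= n)%N) (hr : 0 < r) (heps : 0 <= eps < 1).
Hypothesis hpyr : 0 < altitude_radicand n eps.
Local Notation al := (alpha R n).
Local Notation b := (altitude n r eps).
Local Notation h := (pi / n%:R : R).
Local Notation face_pt := (face_pt n r eps).

Definition prism_face i := parallelogram (vertex n r (- (eps * r)) i)
  (vertex n r (- (eps * r)) i.+1) (vertex n r (eps * r) i).

Definition pyramid_face (c a : R) i :=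
  triangle (vertex n r c i) (vertex n r c i.+1) (0, 0, a).

Let eps0 : 0 <= eps. Proof. by case/andP: heps. Qed.
Let eps1 : 0 < 1 - eps. Proof. by rewrite subr_gt0; case/andP: heps. Qed.
Let er0 : 0 <= eps * r. Proof. by rewrite mulr_ge0// ltW. Qed.
Let n_neq0 : n%:R != 0 :> R.
Proof. by rewrite pnatr_eq0 -lt0n (leq_trans _ hn). Qed.
Let sh_neq0 : sin h != 0.
Proof. by rewrite gt_eqF ?sin_half_gt0. Qed.

Lemma circumradiusE : circumradius n r = r * (h / sin h).
Proof. by rewrite /circumradius; field; rewrite n_neq0 sh_neq0. Qed.

Lemma prism_face_map i u v : 0 <= v <= 1 ->
  patch_map (prism_face i) (u, v) =
  face_pt i (al i + 2 * h * u, eps * r * (2 * v - 1)).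
Proof.
move=> /andP[v0 v1]; rewrite /= affine_mapE /= circumradiusE.
have zb : - (eps * r) <= eps * r * (2 * v - 1) <= eps * r.
  apply/andP; split.
    by rewrite -subr_ge0 opprK -[X in _ + X]mulr1 -mulrDr mulr_ge0//; lra.
  by rewrite -subr_ge0 -[X in X - _]mulr1 -mulrBr mulr_ge0//; lra.
rewrite /face_pt radius_mid// height_mid// w_face_convex//.
by rewrite scale_pairE/=; congr (_, _, _); ring.
Qed.

Lemma cap_scale_cap s : 0 <= s <= 1 ->
  cap_scale r eps (r - r * (1 - eps) * s ^+ 2) = s.
Proof.
move=> /andP[s0 s1]; rewrite cap_scale_above//.
  have -> : (1 - (r - r * (1 - eps) * s ^+ 2) / r) / (1 - eps) = s ^+ 2.
    by field; rewrite !gt_eqF.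
  by rewrite sqrtr_sqr ger0_norm.
rewrite -subr_ge0.
have -> : r - r * (1 - eps) * s ^+ 2 - eps * r = r * (1 - eps) * (1 - s ^+ 2).
  by ring.
by rewrite !mulr_ge0 ?(ltW hr) ?(ltW eps1)// subr_ge0 expr_le1.
Qed.

Lemma cap_bounds s : 0 <= s <= 1 ->
  eps * r <= r - r * (1 - eps) * s ^+ 2 <= r.
Proof.
move=> /andP[s0 s1].
have p : 0 <= r * (1 - eps) by rewrite mulr_ge0 ?(ltW hr) ?(ltW eps1).
have q0 : 0 <= r * (1 - eps) * s ^+ 2 by rewrite mulr_ge0// sqr_ge0.
have q1 : r * (1 - eps) * s ^+ 2 <= r * (1 - eps).
  by rewrite ler_piMr// expr_le1.
by apply/andP; split; move: q0 q1; lra.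
Qed.

(** Here s is the relative size of the section, 1 at the base and 0 at the apex, and u the relative
    position along it. The height on the sphere is the one whose [cap_scale] is s. *)
Lemma upper_face_map i s u : 0 <= s <= 1 ->
  patch_map (pyramid_face (eps * r) (eps * r + b) i) (s * u, 1 - s) =
  face_pt i (al i + 2 * h * u, r - r * (1 - eps) * s ^+ 2).
Proof.
move=> sb; have /andP[zb1 zb2] := cap_bounds sb.
rewrite /= affine_mapE /= circumradiusE /face_pt/=.
rewrite radius_top// height_top// cap_scale_cap// w_face_convex//.
by rewrite scale_pairE/=; congr (_, _, _); ring.
Qed.

Lemma lower_face_map i s u : 0 <= s <= 1 ->
  patch_map (pyramid_face (- (eps * r)) (- (eps * r + b)) i) (s * u, 1 - s) =
  face_pt i (al i + 2 * h * u, - (r - r * (1 - eps) * s ^+ 2)).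
Proof.
move=> sb; have /andP[zb1 zb2] := cap_bounds sb.
rewrite /= affine_mapE /= circumradiusE /face_pt radiusN heightN//.
rewrite radius_top// height_top// cap_scale_cap// w_face_convex//.
by rewrite scale_pairE/=; congr (_, _, _); ring.
Qed.

Lemma sector_scale i t : al i <= t <= al i.+1 ->
  exists2 u, 0 <= u <= 1 & t = al i + 2 * h * u.
Proof.
have h0 : 0 < 2 * h by rewrite mulr_gt0 ?half_angle_gt0.
rewrite alphaS// => /andP[it ti]; exists ((t - al i) / (2 * h)).
  by rewrite divr_ge0 ?(ltW h0) ?subr_ge0// ler_pdivrMr// mul1r lerBlDl.
by rewrite [X in _ + X]mulrC divfK ?gt_eqF// addrC subrK.
Qed.

Lemma sector_scale_bounds i u : 0 <= u <= 1 ->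
  al i <= al i + 2 * h * u <= al i.+1.
Proof.
have h0 : 0 < 2 * h by rewrite mulr_gt0 ?half_angle_gt0.
rewrite alphaS// => /andP[u0 u1]; rewrite lerDl mulr_ge0 ?(ltW h0)//=.
by rewrite lerD2l ler_piMr ?(ltW h0).
Qed.

Lemma triangle_param (p : R * R) : [/\ 0 <= p.1, 0 <= p.2 & p.1 + p.2 <= 1] ->
  [/\ p = ((1 - p.2) * (p.1 / (1 - p.2)), 1 - (1 - p.2)),
      0 <= 1 - p.2 <= 1 & 0 <= p.1 / (1 - p.2) <= 1].
Proof.
case: p => u v /= [u0 v0 uv]; have v1 : 0 <= 1 - v by lra.
(* At the apex the numerator is 0 as well, so the quotient is 0 and stays in range. *)
have [v10|v1n] := eqVneq (1 - v) 0.
  have -> : u = 0 by lra.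
  by rewrite mul0r mulr0; split; [congr (_, _)| |]; lra.
have v1p : 0 < 1 - v by rewrite lt_neqAle eq_sym v1n.
split; first by rewrite mulrC divfK// opprB addrC subrK.
  by rewrite v1; lra.
by rewrite divr_ge0//= ler_pdivrMr// mul1r; lra.
Qed.

Lemma upper_pyramidP q : upper_pyramid n r eps q <->
  exists i t z, [/\ (i < n)%N, al i <= t <= al i.+1, eps * r <= z <= r &
                    q = face_pt i (t, z)].
Proof.
split=> [/faces_unionP[i ltin [p /triangle_param[pE sb ub] <-]]|].
  exists i, (al i + 2 * h * (p.1 / (1 - p.2))).
  exists (r - r * (1 - eps) * (1 - p.2) ^+ 2).
  split=> //; first exact: sector_scale_bounds; first exact: cap_bounds.
  by rewrite pE upper_face_map -?pE.
move=> [i [t [z [ltin it zb ->]]]]; apply/faces_unionP; exists i => //.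
have [u /andP[u0 u1] ->] := sector_scale it; have /andP[z0 z1] := zb.
set s := cap_scale r eps z.
have s0 : 0 <= s by exact: cap_scale_ge0.
have s1 : s <= 1 by exact: cap_scale_le1.
(* Once rewritten in terms of s, this says that z is the height reached at the triangle parameter 1
   - s. *)
have zE := height_top_inv hr heps hpyr zb.
have sE : 1 - (height n r eps z - eps * r) / b = s.
  by rewrite height_top// -/s; field; rewrite gt_eqF ?altitude_gt0.
rewrite sE in zE; exists (s * u, 1 - s).
  by split=> /=; [exact: mulr_ge0|lra|have := ler_wpM2l s0 u1; lra].
by rewrite [LHS]upper_face_map -?zE ?s0.
Qed.

Lemma lower_pyramidP q : lower_pyramid n r eps q <->
  exists i t z, [/\ (i < n)%N, al i <= t <= al i.+1, - r <= z <= - (eps * r) &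
                    q = face_pt i (t, z)].
Proof.
split=> [/faces_unionP[i ltin [p /triangle_param[pE sb ub] <-]]|].
  exists i, (al i + 2 * h * (p.1 / (1 - p.2))).
  exists (- (r - r * (1 - eps) * (1 - p.2) ^+ 2)).
  split=> //; first exact: sector_scale_bounds.
    by have /andP[? ?] := cap_bounds sb; rewrite !lerN2; apply/andP; split.
  by rewrite pE lower_face_map -?pE.
move=> [i [t [z [ltin it zb ->]]]]; apply/faces_unionP; exists i => //.
have [u /andP[u0 u1] ->] := sector_scale it; have /andP[z0 z1] := zb.
have zb' : eps * r <= - z <= r by apply/andP; split; lra.
set s := cap_scale r eps (- z).
have s0 : 0 <= s by exact: cap_scale_ge0.
have s1 : s <= 1 by exact: cap_scale_le1.
have zE := height_top_inv hr heps hpyr zb'.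
have sE : 1 - (height n r eps (- z) - eps * r) / b = s.
  by rewrite height_top// -/s; [field; rewrite gt_eqF ?altitude_gt0|lra].
rewrite sE in zE; exists (s * u, 1 - s).
  by split=> /=; [exact: mulr_ge0|lra|have := ler_wpM2l s0 u1; lra].
by rewrite [LHS]lower_face_map -?zE ?opprK ?s0.
Qed.

Lemma prismP q : prism n r eps q <->
  exists i t z, [/\ (i < n)%N, al i <= t <= al i.+1, - (eps * r) <= z <= eps * r &
                    q = face_pt i (t, z)].
Proof.
split=> [/faces_unionP[i ltin [[u v] /= [ub vb] <-]]|].
  exists i, (al i + 2 * h * u), (eps * r * (2 * v - 1)).
  split=> //; first exact: sector_scale_bounds; last exact: prism_face_map.
  have /andP[v0 v1] := vb.
  have := mulr_ge0 er0 v0; have := ler_wpM2l er0 v1.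
  by move=> ? ?; apply/andP; split; lra.
move=> [i [t [z [ltin it zb ->]]]]; apply/faces_unionP; exists i => //.
have [u ub ->] := sector_scale it; have /andP[z0 z1] := zb.
(* For [eps = 0] the face is an edge in the plane z = 0 and v = 0 is taken; otherwise v solves
   [eps * r * (2 * v - 1) = z]. *)
have [e00|en0] := eqVneq (eps * r) 0.
  exists (u, 0); first by split=> //=; rewrite lexx ler01.
  rewrite [LHS]prism_face_map ?lexx ?ler01// e00 mul0r.
  by have -> : z = 0 by lra.
have e1 : 0 < eps * r by rewrite lt_neqAle eq_sym en0 er0.
have vb : 0 <= (z + eps * r) / (2 * (eps * r)) <= 1.
  rewrite divr_ge0/=; [|lra|lra].
  by rewrite ler_pdivrMr; lra.
exists (u, (z + eps * r) / (2 * (eps * r))); first by split.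
rewrite [LHS]prism_face_map//; congr (face_pt i (_, _)).
have zE c : c != 0 -> c * (2 * ((z + c) / (2 * c)) - 1) = z.
  by move=> c0; field.
exact: zE.
Qed.

Lemma polyhedronP q : polyhedron n r eps q <->
  exists i t z, [/\ (i < n)%N, al i <= t <= al i.+1, - r <= z <= r &
                    q = face_pt i (t, z)].
Proof.
have er1 : eps * r <= r by rewrite ler_piMl ?(ltW hr)//; case/andP: heps => _ /ltW.
split=> [[[/prismP|/upper_pyramidP]|/lower_pyramidP]|].
- move=> [i [t [z [? ? ? ?]]]]; exists i, t, z; split=> //; lra.
- move=> [i [t [z [? ? ? ?]]]]; exists i, t, z; split=> //; have := er0; lra.
- move=> [i [t [z [? ? ? ?]]]]; exists i, t, z; split=> //; have := er0; lra.
move=> [i [t [z [ltin it /andP[z0 z1] qE]]]].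
have [ze|ze] := leP (eps * r) z.
  by left; right; apply/upper_pyramidP; exists i, t, z; rewrite ze.
have [ze'|ze'] := leP z (- (eps * r)).
  by right; apply/lower_pyramidP; exists i, t, z; rewrite ze' z0.
by left; left; apply/prismP; exists i, t, z; rewrite (ltW ze) (ltW ze').
Qed.

Lemma T_map_bij : set_bij (sphere r) (polyhedron n r eps) (T_map n r eps).
Proof.
split.
- move=> q Sq; have [i [t [ltin it zb qE]]] := sphere_param hn hr Sq.
  apply/polyhedronP; exists i, t, q.2; split=> //.
  by rewrite {1}qE (T_map_sphere_pt hn hr heps ltin it zb).
- by move=> p q /set_mem Sp /set_mem Sq; exact: (T_map_inj hn).
- move=> _ /polyhedronP[i [t [z [ltin it zb ->]]]].
  exists (sphere_pt r (t, z)); first exact: sphere_sphere_pt.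
  exact: T_map_sphere_pt.
Qed.

Lemma T_map_inverse (X Y Z x y z : R) (i : nat) :
  polyhedron n r eps (X, Y, Z) -> (i < n)%N ->
  (exists2 t : R, al i <= t <= al i.+1 & polar_angle X Y t) ->
  sphere r (x, y, z) -> T_map n r eps (x, y, z) = (X, Y, Z) ->
  let a := al i in
  let lam := pi / (n%:R * sin h) *
      ((- X * sin a + Y * cos a) / (X * cos (a + h) + Y * sin (a + h))) in
  let mu := (Y * cos a - X * sin a) / (r * cos h) in
  [/\ upper_pyramid n r eps (X, Y, Z) ->
        z = r - r * (1 - eps) * (1 - (Z - eps * r) / b) ^+ 2,
      lower_pyramid n r eps (X, Y, Z) ->
        z = r * (1 - eps) * (1 - (`|Z| - eps * r) / b) ^+ 2 - r,
      upper_pyramid n r eps (X, Y, Z) \/ lower_pyramid n r eps (X, Y, Z) ->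
        if (X == 0) && (Y == 0) then x = 0 /\ y = 0
        else x = Num.sqrt (r ^+ 2 - z ^+ 2) * cos (lam + a) /\
             y = Num.sqrt (r ^+ 2 - z ^+ 2) * sin (lam + a)
    & prism n r eps (X, Y, Z) ->
        [/\ z = Z,
            x = Num.sqrt (r ^+ 2 - Z ^+ 2) * cos (mu + a)
          & y = Num.sqrt (r ^+ 2 - Z ^+ 2) * sin (mu + a)]].
Proof.
move=> _ ltin pol Sq Tq a lam mu.
have [t [it zb qE fE]] := T_map_param hn hr heps Sq ltin pol Tq.
rewrite /= in zb qE fE; have /andP[z0 z1] := zb.
have ch : 0 < cos h by exact: cos_half_gt0.
have rho0 : 0 < h / sin h by exact: rho_gt0.
case wE : (w_face n i t) => [w1 w2].
have [XE YE ZE] : [/\ X = radius r eps z * w1, Y = radius r eps z * w2 &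
    Z = height n r eps z].
  by move: fE; rewrite /face_pt [w_face _ _ _]wE/=; case.
(* The cross and dot products of (X, Y) are those of the edge point times [radius]. This factor
   cancels in [lam]; on the prism it equals r, the factor in the denominator of [mu]. *)
have cr : Y * cos a - X * sin a = radius r eps z * ((t - a) * cos h).
  by rewrite -(w_face_cross hn i t) wE XE YE/=; ring.
have dt : X * cos (a + h) + Y * sin (a + h) =
    radius r eps z * (h / sin h * cos h).
  by rewrite -(w_face_dot hn i t) wE XE YE/=; ring.
have [xE yE] : x = Num.sqrt (r ^+ 2 - z ^+ 2) * cos t /\
               y = Num.sqrt (r ^+ 2 - z ^+ 2) * sin t.
  by move: qE; rewrite /sphere_pt/=; case.
split.
(* Membership yields other parameters (j, u, z'), not known to be those of the preimage. Only the
   common height is used: [height_ge] transfers the zone from z' to z. *)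
- move=> /upper_pyramidP[j [u [z' [_ _ z'b e]]]].
  have Z' : Z = height n r eps z' by case: e.
  rewrite ZE; apply: height_top_inv => //.
  by rewrite z1 -(@height_ge _ n)// -ZE Z' height_ge//; case/andP: z'b => ->.
- move=> /lower_pyramidP[j [u [z' [_ _ z'b e]]]].
  have Z' : Z = height n r eps z' by case: e.
  have zle : z <= - (eps * r).
    by rewrite -(@height_le _ n)// -ZE Z' height_le//; case/andP: z'b.
  have Zle : Z <= 0.
    by rewrite ZE (le_trans (_ : _ <= - (eps * r)))// ?height_le// oppr_le0.
  apply: oppr_inj; rewrite ler0_norm// ZE -heightN// opprB.
  by apply: height_top_inv => //; apply/andP; split; lra.
(* X = Y = 0 happens only at a pole: elsewhere [radius] is positive and the edge avoids the
   origin. *)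
- move=> _; case: ifPn => [/andP[/eqP X0 /eqP Y0]|XY].
    have [zb'|zp] := sphere_bounds_cases zb; last first.
      by move: qE; rewrite sphere_pt_pole// => -[-> ->].
    case: (w_face_neq0 hn (i := i) (t := t)); rewrite wE.
    have rn : radius r eps z != 0 by rewrite gt_eqF// radius_gt0.
    by congr (_, _); apply: (mulfI rn); rewrite mulr0 -?XE -?YE.
  have rn : radius r eps z != 0.
    by apply: contra XY => /eqP rz; rewrite XE YE rz !mul0r eqxx.
  suff -> : lam + a = t by [].
  rewrite /lam mulNr addrC (addrC (- _)) cr dt.
  have -> : pi / (n%:R * sin h) = h / sin h by field; rewrite n_neq0 sh_neq0.
  move: (h / sin h) (cos h) rho0 ch => rho c rho0 ch.
  by rewrite /a; field; rewrite rn !gt_eqF.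
- move=> /prismP[j [u [z' [_ _ z'b e]]]].
  have Z' : Z = height n r eps z' by case: e.
  have ZE' : Z = z' by rewrite Z' height_mid.
  have zz : z = z'.
    have er1 : eps * r <= r by rewrite ler_piMl ?(ltW hr)//; case/andP: heps => _ /ltW.
    apply: (@height_inj R n r eps) => //; rewrite -?ZE -?Z'//; lra.
  rewrite ZE' -zz; split=> //.
    suff -> : mu + a = t by [].
    by rewrite /mu cr radius_mid// ?zz// /a; field; rewrite !gt_eqF.
  suff -> : mu + a = t by [].
  by rewrite /mu cr radius_mid// ?zz// /a; field; rewrite !gt_eqF.
Qed.

End Faces.

(** * Continuity *)

Lemma continuous_pair (S T U : topologicalType) (f : S -> T) (g : S -> U) :
  continuous f -> continuous g -> continuous (fun x => (f x, g x)).
Proof. by move=> cf cg x; apply: cvg_pair; [exact: cf|exact: cg]. Qed.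

Section Continuity.
Variables (R : realType) (n : nat) (r eps : R).
Hypotheses (hn : (3 <= n)%N) (hr : 0 < r) (heps : 0 <= eps < 1).
Local Notation al := (alpha R n).

Let continuous_comp_fst (f : R -> R) :
  continuous f -> continuous (fun p : R * R => f p.1).
Proof.
by move=> cf p; apply: (@continuous_comp _ _ _ fst f); [exact: cvg_fst|exact: cf].
Qed.

Let continuous_comp_snd (f : R -> R) :
  continuous f -> continuous (fun p : R * R => f p.2).
Proof.
by move=> cf p; apply: (@continuous_comp _ _ _ snd f); [exact: cvg_snd|exact: cf].
Qed.

Lemma continuous_parallel_radius :
  continuous (fun z : R => Num.sqrt (r ^+ 2 - z ^+ 2)).
Proof.
move=> z; apply: (@continuous_comp _ _ _ (fun z : R => r ^+ 2 - z ^+ 2)).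
  by apply: cvgB; [exact: cvg_cst|exact: exprn_continuous].
exact: sqrt_continuous.
Qed.

Lemma continuous_sphere_pt : continuous (sphere_pt r).
Proof.
apply: (@continuous_pair _ _ _ (fun p : R * R => (Num.sqrt (r ^+ 2 - p.2 ^+ 2) * cos p.1,
  Num.sqrt (r ^+ 2 - p.2 ^+ 2) * sin p.1)) (fun p => p.2)); last by move=> p; exact: cvg_snd.
apply: continuous_pair => p; apply: cvgM.
- exact: continuous_comp_snd continuous_parallel_radius p.
- exact: continuous_comp_fst (@continuous_cos R) p.
- exact: continuous_comp_snd continuous_parallel_radius p.
- exact: continuous_comp_fst (@continuous_sin R) p.
Qed.

Lemma continuous_cap_scale : continuous (cap_scale r eps).
Proof.
move=> z; apply: (@continuous_comp _ _ _
  (fun z : R => Num.min 1 ((1 - z / r) / (1 - eps)))).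
  apply: continuous_min; first exact: cvg_cst.
  apply: cvgMl; apply: cvgB; first exact: cvg_cst.
  by apply: cvgMl; exact: cvg_id.
exact: sqrt_continuous.
Qed.

Let continuous_cap_scaleN : continuous (fun z => cap_scale r eps (- z)).
Proof.
move=> z; apply: (@continuous_comp _ _ _ -%R); first exact: opp_continuous.
exact: continuous_cap_scale.
Qed.

Lemma continuous_radius : continuous (radius r eps).
Proof.
move=> z; apply: cvgM; last exact: continuous_cap_scaleN.
by apply: cvgM; [exact: cvg_cst|exact: continuous_cap_scale].
Qed.

Lemma continuous_height : continuous (height n r eps).
Proof.
move=> z; apply: cvgB; last first.
  apply: cvgM; first exact: cvg_cst.
  by apply: cvgB; [exact: cvg_cst|exact: continuous_cap_scaleN].
apply: cvgD; last first.
  apply: cvgM; first exact: cvg_cst.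
  by apply: cvgB; [exact: cvg_cst|exact: continuous_cap_scale].
apply: (@continuous_max R R (fun=> - (eps * r)) (fun z => Num.min (eps * r) z)).
  exact: cvg_cst.
by apply: (@continuous_min R R (fun=> eps * r) id); [exact: cvg_cst|exact: cvg_id].
Qed.

Lemma continuous_face_pt i : continuous (face_pt n r eps i).
Proof.
have lin (c d : R) : continuous (fun q : R * R => c + d * (q.1 - al i)).
  move=> p; apply: cvgD; first exact: cvg_cst.
  apply: cvgM; first exact: cvg_cst.
  by apply: cvgB; [exact: cvg_fst|exact: cvg_cst].
apply: (@continuous_pair _ _ _ (fun p : R * R => radius r eps p.2 *: w_face n i p.1)
  (fun p => height n r eps p.2)); last exact: continuous_comp_snd continuous_height.
apply: (@continuous_pair _ _ _ (fun p : R * R => radius r eps p.2 * (w_face n i p.1).1)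
  (fun p => radius r eps p.2 * (w_face n i p.1).2)) => p; apply: cvgM.
- exact: continuous_comp_snd continuous_radius p.
- rewrite /w_face/=; under eq_fun do rewrite -mulNr.
  by rewrite -mulNr; exact: lin.
- exact: continuous_comp_snd continuous_radius p.
- exact: lin.
Qed.

(* The preimage of a closed set is a finite union of continuous images of
   compact sets of coordinates. *)
Lemma T_map_continuous : {within sphere r, continuous (T_map n r eps)}.
Proof.
apply/continuous_closedP => C cC; apply/closed_subspaceP.
(* Sectors and heights are taken closed to make K i compact; the overlaps are harmless because
   [T_map_sphere_pt] holds on closed sectors. *)
pose K i := (`[al i, al i.+1]%classic `*` `[- r, r]%classic) `&`
  face_pt n r eps i @^-1` C.
exists (\bigcup_(i in `I_n) (sphere_pt r @` K i)).
  apply: closed_bigcup; first exact: finite_II.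
  move=> i _; apply: compact_closed; first exact: norm_hausdorff.
  apply: continuous_compact.
    by apply: continuous_subspaceT; exact: continuous_sphere_pt.
  apply: compact_closedI.
    by apply: compact_setX; exact: segment_compact.
  by move/continuous_closedP : (@continuous_face_pt i); apply.
rewrite eqEsubset; split=> q [].
  move=> [i ltin [[t z] [[/= it zb] Cf] <-]] Sq; split=> //=.
  move: it zb; rewrite !in_itv/= => it zb.
  change (C (T_map n r eps (sphere_pt r (t, z)))).
  by rewrite (T_map_sphere_pt hn hr heps ltin it zb).
move=> Cq Sq; split=> //.
have [i [t [ltin it zb qE]]] := sphere_param hn hr Sq.
exists i => //; exists (t, q.2); last by rewrite -qE.
split; first by split; rewrite /= in_itv.
change (C (face_pt n r eps i (t, q.2))).
by rewrite -(T_map_sphere_pt hn hr heps ltin it zb) -qE.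
Qed.

End Continuity.

(** * Change of variables *)

Section ImageDensity.
Context d1 d2 (T1 : measurableType d1) (T2 : measurableType d2) (R : realType).
Variables (mu : {measure set T1 -> \bar R}) (D : set T1) (f : T1 -> \bar R).
Variable Phi : T1 -> T2.

(* The image by Phi of the measure of density f on D.  The unused arguments let
   the measure structure be inferred from the term. *)
Definition image_density (_ : measurable D) (_ : measurable_fun D f)
    (_ : forall x, D x -> (0 <= f x)%E) (_ : measurable_fun D Phi)
    (A : set T2) : \bar R :=
  (\int[mu]_(x in D `&` Phi @^-1` A) f x)%E.

Hypotheses (mD : measurable D) (mf : measurable_fun D f).
Hypotheses (f0 : forall x, D x -> (0 <= f x)%E) (mPhi : measurable_fun D Phi).
Local Notation nu := (image_density mD mf f0 mPhi).

Let nu0 : nu set0 = 0%E.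
Proof. by rewrite /image_density preimage_set0 setI0 integral_set0. Qed.

Let nu_ge0 A : (0 <= nu A)%E.
Proof. by apply: integral_ge0 => x [Dx _]; exact: f0. Qed.

Let nu_sigma_additive : semi_sigma_additive nu.
Proof.
move=> F mF tF mUF; rewrite /image_density; apply: cvg_toP.
  apply: ereal_nondecreasing_is_cvgn => m n mn.
  by apply: lee_sum_nneg_natr => // k _ _; exact: nu_ge0.
rewrite preimage_bigcup setI_bigcupr ge0_integral_bigcup//=.
- by move=> k; exact: mPhi.
- by apply: measurable_funS mf => // x [k _ []].
- by move=> x [k _ [Dx _]]; exact: f0.
- apply/trivIsetP => i j _ _ ij.
  move/trivIsetP : tF => /(_ i j Logic.I Logic.I ij) FF.
  by rewrite setIACA setIid -preimage_setI FF preimage_set0 setI0.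
Qed.

HB.instance Definition _ := isMeasure.Build _ _ _ nu
  nu0 nu_ge0 nu_sigma_additive.

End ImageDensity.

(** * One-dimensional substitution over preimages of Borel sets *)

Section MonotoneSubstitution.
Variable R : realType.
Local Notation mu := (@lebesgue_measure R).

Lemma integral_is_derive (F f : R -> R) (a b : R) : a <= b ->
  (forall x, is_derive x (1 : R) F (f x)) -> continuous f ->
  (\int[mu]_(x in `[a, b]) (f x)%:E = (F b - F a)%:E)%E.
Proof.
rewrite le_eqVlt => /predU1P[<- _ _|ab dF cf].
  by rewrite set_itv1 integral_set1 subrr.
have cF : continuous F.
  by move=> x; apply/differentiable_continuous/derivable1_diffP; case: (dF x).
rewrite (@continuous_FTC2 _ f F)//.
- exact: continuous_subspaceT.
- split; first by move=> x _; case: (dF x).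
    exact: cvg_at_right_filter (cF a).
  exact: cvg_at_left_filter (cF b).
- by move=> x _; rewrite derive1E; exact: derive_val.
Qed.

(* Both sides are finite measures in B; they agree on the half-lines. *)
Lemma integral_increasing_preimage (F f : R -> R) (a b : R) (B : set R) :
  a <= b -> (forall x, is_derive x (1 : R) F (f x)) -> continuous f ->
  {in `[a, b], forall x, 0 <= f x} ->
  {in `[a, b] &, {mono F : x y / x <= y}} -> measurable B ->
  (\int[mu]_(x in `[a, b] `&` F @^-1` B) (f x)%:E =
   mu (B `&` `[F a, F b]))%E.
Proof.
move=> ab dF cf f0 mF mB.
have cF : continuous F.
  by move=> x; apply/differentiable_continuous/derivable1_diffP; case: (dF x).
have aab : a \in `[a, b] by rewrite in_itv/= lexx.
have bab : b \in `[a, b] by rewrite in_itv/= lexx andbT.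
have FaFb : F a <= F b by rewrite mF.
pose D : set (measurableTypeR R) := `[a, b]%classic.
have mD : measurable D by exact: measurable_itv.
have mfE : measurable_fun D (fun x : measurableTypeR R => (f x)%:E).
  apply/measurable_EFinP; apply: measurable_funTS.
  exact: continuous_measurable_fun.
have fE0 x : D x -> (0 <= (f x)%:E)%E by rewrite lee_fin => Dx; exact: f0.
have mFD : measurable_fun D (F : measurableTypeR R -> measurableTypeR R).
  by apply: measurable_funTS; exact: continuous_measurable_fun.
pose J : set (measurableTypeR R) := `[F a, F b]%classic.
have mJ : measurable J by exact: measurable_itv.
apply/esym.
apply: (@measure_unique _ R (measurableTypeR R) (@RGenCInfty.G R)
  (fun k => `[(- k%:R), +oo[%classic) _ _ _ _
  (mrestr mu mJ) (image_density mu mD mfE fE0 mFD)) => //.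
- exact: RGenCInfty.measurableE.
- move=> _ _ [x ->] [y ->]; exists (Num.max x y).
  by apply/seteqP; split=> z /=; rewrite !in_itv/= !andbT ge_max => /andP.
- by move=> k; eexists.
- rewrite -subTset => x _; exists (Num.truncn `|x|).+1 => //=.
  rewrite in_itv/= andbT lerNl; apply: le_trans (ler_norm _) _; rewrite normrN.
  by rewrite ltW// truncnS_gt.
- move=> _ [x ->]; rewrite /= /mrestr /image_density /J /D.
  have [xb|bx] := leP x (F b); last first.
    rewrite [X in _ X = _](_ : _ = set0); last first.
      rewrite -subset0 => z [/=]; rewrite !in_itv/= andbT => xz /andP[_ zb].
      by move: (lt_le_trans bx xz); rewrite ltNge zb.
    rewrite [X in integral _ X _](_ : _ = set0) ?measure0 ?integral_set0//.
    rewrite -subset0 => z [/= zab]; rewrite in_itv/= andbT => xz.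
    by move: (lt_le_trans bx xz); rewrite ltNge mF//; move: zab; rewrite in_itv/= => /andP[_ ->].
  (* The preimage of the half-line from x is [c, b]: c comes from the intermediate value theorem, or
     is a when x does not exceed [F a]. The integral over [c, b] is then given by the fundamental
     theorem of calculus. *)
  have [c cab [cE1 cE2]] : exists2 c, c \in `[a, b] & (Num.max x (F a) = F c) /\
      forall z, z \in `[a, b] -> (x <= F z) = (c <= z).
    have [xa|ax] := leP x (F a).
      exists a => //; split=> // z zab; move: (zab); rewrite in_itv/= => /andP[az _].
      by rewrite az (le_trans xa)// mF.
    have [||c cab Fc] := @IVT R F a b x ab.
    + exact: continuous_subspaceT.
    + by rewrite ge_min (ltW ax) le_max xb orbT.
    by exists c => //; split=> // z zab; rewrite -Fc mF.
  have cb : c <= b by move: cab; rewrite in_itv/= => /andP[].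
  rewrite [X in _ X = _](_ : _ = `[F c, F b]%classic); last first.
    apply/seteqP; split=> z /=; rewrite !in_itv/= -cE1 ge_max andbT.
      by move=> [-> /andP[-> ->]].
    by move=> /andP[/andP[-> ->] ->].
  rewrite [X in integral _ X _](_ : _ = `[c, b]%classic); last first.
    apply/seteqP; split=> z /=; rewrite !in_itv/= andbT.
      by move=> [zab]; rewrite cE2 ?in_itv// => ->; case/andP: zab.
    move=> /andP[cz zb]; have zab : a <= z <= b.
      by rewrite zb andbT (le_trans _ cz)//; move: cab; rewrite in_itv/= => /andP[].
    by split=> //; rewrite cE2 ?in_itv.
  rewrite integral_is_derive// lebesgue_measure_itv/= lte_fin.
  case: ltP => // bc; suff -> : F b - F c = 0 by [].
  by apply/eqP; rewrite subr_eq0 eq_le bc mF.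
- move=> k; rewrite /mrestr; apply: (@le_lt_trans _ _ (mu J)).
    by apply: measureIr => //; exact: measurable_itv.
  by rewrite lebesgue_measure_itv/=; case: ifP => _; rewrite ?ltry.
Qed.

(** This is the increasing case for - F and the reflected set; Lebesgue measure is invariant under
    reflection. *)
Lemma integral_decreasing_preimage (F f : R -> R) (a b : R) (B : set R) :
  a <= b -> (forall x, is_derive x (1 : R) F (- f x)) -> continuous f ->
  {in `[a, b], forall x, 0 <= f x} ->
  {in `[a, b] &, {mono F : x y /~ x <= y}} -> measurable B ->
  (\int[mu]_(x in `[a, b] `&` F @^-1` B) (f x)%:E =
   mu (B `&` `[F b, F a]))%E.
Proof.
move=> ab dF cf f0 mF mB.
have mNB : measurable ((-%R : measurableTypeR R -> measurableTypeR R) @^-1` B).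
  rewrite -[X in measurable X]setTI.
  exact: (@oppr_measurable R setT measurableT B mB).
have dFN (x : R) : is_derive x (1 : R) (fun x => - F x) (f x).
  by have dFx := dF x; rewrite -[f x]opprK; exact: is_deriveN.
have FN : {in `[a, b] &, {mono (fun x => - F x) : x y / x <= y}}.
  by move=> x y xab yab; rewrite lerN2 mF.
have := integral_increasing_preimage ab dFN cf f0 FN mNB.
have -> : (fun x => - F x) @^-1` (-%R @^-1` B) = F @^-1` B.
  by apply/funext => x /=; rewrite /preimage/= opprK.
move=> H; rewrite {}H.
have mI : measurable (B `&` `[F b, F a]%classic).
  by apply: measurableI => //; exact: measurable_itv.
rewrite -[RHS](lebesgue_measureN mI); congr (_ _).
apply/seteqP; split=> z /=; rewrite !in_itv/=.
  by move=> [Bz /andP[? ?]]; split=> //; rewrite lerNr lerNl; apply/andP.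
by move=> [Bz]; rewrite lerNr lerNl => /andP[? ?]; split=> //; apply/andP.
Qed.

End MonotoneSubstitution.

(** * Two-dimensional substitution, skew over the second variable *)

Section RectanglePreimage.
Variable R : realType.
Local Notation T := (measurableTypeR R).
Local Notation mu := (@lebesgue_measure R).
Local Open Scope ereal_scope.

(* Both sides are finite measures in E; on a rectangle E = A x B the left-hand
   side is computed by Tonelli's theorem. *)
Lemma integral_skew_preimage (dom : set (T * T)) (G : T * T -> T)
    (F g f : T -> T) (a b c : R) (I J : set T) (E : set (T * T)) :
  measurable dom -> measurable_fun setT G -> measurable_fun setT F ->
  measurable_fun setT g -> measurable_fun setT f ->
  (forall p, dom p -> (0 <= g p.2)%R) ->
  (forall p, dom p -> p.2 \in `[a, b]) ->
  (forall v, v \in `[a, b] -> (0 <= f v)%R) ->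
  measurable I -> measurable J -> mu I < +oo -> mu J < +oo -> (0 <= c)%R ->
  (forall v A, v \in `[a, b] -> measurable A ->
    (g v)%:E * mu [set u | dom (u, v) /\ A (G (u, v))] =
    (c * f v)%:E * mu (A `&` I)) ->
  (forall B, measurable B ->
    \int[mu]_(v in `[a, b] `&` F @^-1` B) (f v)%:E = mu (B `&` J)) ->
  measurable E ->
  \int[mu \x mu]_(p in dom `&` (fun p => (G p, F p.2)) @^-1` E) (g p.2)%:E =
  c%:E * (mu \x mu) (E `&` (I `*` J)).
Proof.
move=> mdom mG mF mg mf g0 domab f0 mI mJ Ioo Joo c0 inner outer mE.
pose Phi (p : T * T) : T * T := (G p, F p.2).
have mPhi : measurable_fun dom Phi.
  apply: measurable_funTS; apply: measurable_fun_pair => //.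
  exact: measurableT_comp mF (@measurable_snd _ _ T T).
have mgE : measurable_fun setT (fun p : T * T => (g p.2)%:E).
  apply/measurable_EFinP.
  exact: measurableT_comp mg (@measurable_snd _ _ T T).
have mgD : measurable_fun dom (fun p : T * T => (g p.2)%:E).
  exact: measurable_funTS.
have g0E p : dom p -> 0 <= (g p.2)%:E by rewrite lee_fin => /g0.
have mIJ : measurable (I `*` J) by exact: measurableX.
apply/esym.
apply: (@measure_unique _ R _
  [set C | exists A, measurable A /\ exists B, measurable B /\ C = A `*` B]
  (fun=> setT) _ _ _ _
  (mscale (NngNum c0) (mrestr (mu \x mu) mIJ))
  (image_density (mu \x mu) mdom mgD g0E mPhi)) => //.
- rewrite measurable_prod_measurableType //; congr (<<s _ >>).
  rewrite predeqE; split => [[A mA [B mB <-]]|[A [mA [B [mB ->]]]]].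
    by exists A; split => //; exists B.
  by exists A => //; exists B.
- move=> /= _ _ [X1 [mX1 [X2 [mX2 ->]]]] [Y1 [mY1 [Y2 [mY2 ->]]]].
  rewrite -setXI; exists (X1 `&` Y1); split; first exact: measurableI.
  by exists (X2 `&` Y2); split => //; exact: measurableI.
- by move=> _; exists setT; split=> //; exists setT; split=> //; rewrite setXTT.
- by rewrite -subTset => p _; exists 0%N.
- move=> _ [A [mA [B [mB ->]]]]; rewrite /= /mscale /= /mrestr -setXI.
  rewrite product_measure1E; [|exact: measurableI..].
  have mD' : measurable (`[a, b]%classic `&` F @^-1` B : set T).
    by apply: measurableI; [exact: measurable_itv|rewrite -[X in measurable X]setTI; exact: mF].
  have mS : measurable (dom `&` Phi @^-1` (A `*` B)).
    by apply: mPhi => //; exact: measurableX.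
  rewrite /image_density integral_mkcond fubini_tonelli2; last 2 first.
  + apply/(measurable_restrictT _ _).1 => //.
    exact: measurable_funS mgE.
  + move=> p; rewrite patchE; case: ifPn => // /set_mem[dp _]; exact: g0E.
  (* For fixed v the weight is constant in u, so the inner integral is [g v] times the measure of a
     slice, which [inner] rewrites; for v outside this domain the restricted integrand is 0. *)
  transitivity (\int[mu]_(v in `[a, b] `&` F @^-1` B)
      ((c * f v)%:E * mu (A `&` I))); last first.
    rewrite [LHS]integral_mkcond; apply: eq_integral => v _.
    rewrite /fubini_G patchE; case: ifPn => [/set_mem[/= vab Bv]|/negP vD].
      rewrite -inner//.
      have mSv : measurable [set u | dom (u, v) /\ A (G (u, v))].
        have -> : [set u | dom (u, v) /\ A (G (u, v))] =
            (fun u : T => (u, v)) @^-1` (dom `&` G @^-1` A) by [].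
        rewrite -[X in measurable X]setTI; apply: measurable_pair2 => //.
        by apply: measurableI => //; rewrite -[X in measurable X]setTI; exact: mG.
      rewrite -integral_cst// [LHS]integral_mkcond; apply: eq_integral => u _.
      rewrite !patchE; congr (if _ then _ else _); apply/idP/idP; rewrite !inE.
        by move=> [? ?]; split=> //; split.
      by move=> [? [? ?]]; split.
    rewrite integral0_eq// => u _; rewrite patchE; case: ifPn => // /set_mem[du [_ Bv]].
    by case: vD; apply/mem_set; split=> //; exact: domab du.
  have mfE : measurable_fun (`[a, b]%classic `&` F @^-1` B) (fun v : T => (f v)%:E).
    by apply/measurable_EFinP; exact: measurable_funTS.
  have fE0 v : (`[a, b]%classic `&` F @^-1` B) v -> 0 <= (f v)%:E.
    by move=> [vab _]; rewrite lee_fin; exact: f0.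
  rewrite ge0_integralZr//; last 2 first.
  + by apply/measurable_EFinP; apply: measurable_funM => //; exact: measurable_funTS.
  + by move=> v Dv; rewrite EFinM mule_ge0// fE0.
  under eq_integral do rewrite EFinM.
  by rewrite ge0_integralZl// outer// -muleA [mu _ * mu _]muleC.
- move=> _; rewrite /= /mscale /= /mrestr setTI.
  rewrite product_measure1E// lte_mul_pinfty//.
  by rewrite lte_mul_pinfty// ge0_fin_numE.
Qed.

End RectanglePreimage.

(** * Areas *)

Section Densities.
Variable R : realType.

(** The difference quotient is constant on the punctured line. *)
Lemma derive_affine (V W : normedModType R) (f : V -> W) (p v : V) (w : W) :
  (forall h : R, f (h *: v + p) = f p + h *: w) -> 'D_v f p = w.
Proof.
move=> H; rewrite /derive; apply: cvg_lim; first exact: norm_hausdorff.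
apply: cvg_near_cst; near=> h.
rewrite /= H addrC addKr scalerA mulVf ?scale1r//.
by near: h; exact: nbhs_dnbhs_neq.
Unshelve. all: by end_near. Qed.

Lemma is_derive_pair (V W : normedModType R) (f : R -> V) (g : R -> W) (x : R) df dg :
  is_derive x (1 : R) f df -> is_derive x (1 : R) g dg ->
  is_derive x (1 : R) (fun y => (f y, g y)) (df, dg).
Proof.
move=> [dvf <-] [dvg <-].
have c : (fun h : R => h^-1 *: ((fun y => (f y, g y)) (h *: (1 : R) + x) - (f x, g x)))
    @ (0 : R)^' --> ('D_1 f x, 'D_1 g x).
  exact: cvg_pair dvf dvg.
split; first by apply/cvg_ex; exists ('D_1 f x, 'D_1 g x).
by apply: cvg_lim => //; exact: norm_hausdorff.
Qed.

Lemma derive_fst (W : normedModType R) (f : R * R -> W) (p : R * R) w :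
  is_derive p.1 (1 : R) (fun x => f (x, p.2)) w -> 'D_((1, 0) : R * R) f p = w.
Proof.
move=> [_ <-].
suff E : (fun h : R => h^-1 *: ((f \o shift p) (h *: ((1, 0) : R * R)) - f p)) =
    (fun h : R => h^-1 *: (((fun x => f (x, p.2)) \o shift p.1) (h *: (1 : R)) - f (p.1, p.2))).
  by rewrite /derive E.
apply/funext => h /=; congr (_ *: (f _ - f _)); last by case: (p).
by case: (p) => x y; rewrite [LHS](_ : _ = (h * 1 + x, h * 0 + y))// mulr0 add0r.
Qed.

Lemma derive_snd (W : normedModType R) (f : R * R -> W) (p : R * R) w :
  is_derive p.2 (1 : R) (fun y => f (p.1, y)) w -> 'D_((0, 1) : R * R) f p = w.
Proof.
move=> [_ <-].
suff E : (fun h : R => h^-1 *: ((f \o shift p) (h *: ((0, 1) : R * R)) - f p)) =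
    (fun h : R => h^-1 *: (((fun y => f (p.1, y)) \o shift p.2) (h *: (1 : R)) - f (p.1, p.2))).
  by rewrite /derive E.
apply/funext => h /=; congr (_ *: (f _ - f _)); last by case: (p).
by case: (p) => x y; rewrite [LHS](_ : _ = (h * 0 + x, h * 1 + y))// mulr0 add0r.
Qed.

Lemma area_density_affine (A B C : R * R * R) p :
  area_density (affine_map A B C) p = cross_norm (B - A) (C - A).
Proof.
rewrite /area_density; congr cross_norm; apply: derive_affine => h.
  rewrite /affine_map; case: p => u v /=; rewrite scaler0 add0r [h%:A]mulr1.
  rewrite scalerDl; move: (h *: _) (u *: _) (v *: _) => x y z.
  by rewrite -!addrA; congr (_ + _); rewrite addrC -addrA.
rewrite /affine_map; case: p => u v /=; rewrite scaler0 add0r [h%:A]mulr1.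
by rewrite scalerDl [h *: _ + _]addrC addrA.
Qed.

Lemma area_density_sphere (r : R) p : 0 < r -> 0 <= p.2 <= pi ->
  area_density (patch_map (sphere_patch r)) p = r ^+ 2 * sin p.2.
Proof.
move=> r0 pb; have sp : 0 <= sin p.2 by exact: sin_ge0_pi.
have dcos (c x : R) : is_derive x (1 : R) (fun y => c * cos y) (- (c * sin x)).
  rewrite (_ : (fun y => _) = c *: (@cos R)); last by apply/funext.
  by apply: is_derive_eq; rewrite scalerN.
have dsin (c x : R) : is_derive x (1 : R) (fun y => c * sin y) (c * cos x).
  rewrite (_ : (fun y => _) = c *: (@sin R)); last by apply/funext.
  exact: is_derive_eq.
rewrite /area_density.
have -> : 'D_((1, 0) : R * R) (patch_map (sphere_patch r)) p =
    (- (r * sin p.2 * sin p.1), r * sin p.2 * cos p.1, 0).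
  apply: derive_fst; apply: is_derive_pair; last exact: (is_derive_cst (r * cos p.2)).
  apply: is_derive_pair => /=.
    by under eq_fun do rewrite mulrAC; exact: dcos.
  by under eq_fun do rewrite mulrAC; exact: dsin.
have -> : 'D_((0, 1) : R * R) (patch_map (sphere_patch r)) p =
    (r * cos p.1 * cos p.2, r * sin p.1 * cos p.2, - (r * sin p.2)).
  apply: derive_snd.
  exact: (is_derive_pair (is_derive_pair (dsin (r * cos p.1) p.2)
    (dsin (r * sin p.1) p.2)) (dcos r p.2)).
rewrite /cross_norm/=.
rewrite -[RHS]ger0_norm; last by rewrite mulr_ge0// sqr_ge0.
rewrite -sqrtr_sqr; congr Num.sqrt.
have c1 := cos2Dsin2 p.1; have c2 := cos2Dsin2 p.2.
transitivity (r ^+ 4 * sin p.2 ^+ 2 * (cos p.1 ^+ 2 + sin p.1 ^+ 2) *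
  (sin p.2 ^+ 2 + cos p.2 ^+ 2 * (cos p.1 ^+ 2 + sin p.1 ^+ 2))); first by ring.
by rewrite c1 !mulr1 [_ ^+ 2 + _]addrC c2; ring.
Qed.

End Densities.

Section FaceDensities.
Variables (R : realType) (n : nat) (r eps : R).
Hypotheses (hn : (3 <= n)%N) (hr : 0 < r) (heps : 0 <= eps < 1).
Hypothesis hpyr : 0 < altitude_radicand n eps.
Local Notation al := (alpha R n).
Local Notation b := (altitude n r eps).
Local Notation h := (pi / n%:R : R).

Let sh_neq0 : sin h != 0.
Proof. by rewrite gt_eqF ?sin_half_gt0. Qed.

(** The chord is orthogonal to the direction [al i + h] of its midpoint, and its factor sin h
    cancels against the circumradius. *)
Lemma edgeE i : let k := circumradius n r in
  k * cos (al i.+1) - k * cos (al i) = - (2 * h * r) * sin (al i + h) /\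
  k * sin (al i.+1) - k * sin (al i) = 2 * h * r * cos (al i + h).
Proof.
rewrite /= circumradiusE// alphaS//; set t := al i + h.
have -> : al i + 2 * h = t + h by rewrite /t; ring.
have -> : al i = t - h by rewrite /t; ring.
rewrite cosB sinB cosD sinD; move: sh_neq0; move: (sin h) (cos h) (h) => s c x s0.
by split; field.
Qed.

Lemma area_density_prism_face i p :
  area_density (patch_map (prism_face n r eps i)) p = (2 * h * r) * (2 * (eps * r)).
Proof.
have er0 : 0 <= eps * r by rewrite mulr_ge0 ?(ltW hr)//; case/andP: heps.
have h0 := half_angle_gt0 R hn.
rewrite area_density_affine /cross_norm/=.
have [-> ->] := edgeE i; have p0 : 0 <= 2 * h * r.
  by rewrite mulr_ge0 ?(ltW hr)// mulr_ge0 ?(ltW h0).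
rewrite -[RHS]ger0_norm; last by rewrite mulr_ge0// mulr_ge0.
rewrite -sqrtr_sqr; congr Num.sqrt.
transitivity ((2 * h * r) ^+ 2 * (2 * (eps * r)) ^+ 2 *
  (cos (al i + h) ^+ 2 + sin (al i + h) ^+ 2)); first by ring.
by rewrite cos2Dsin2 mulr1 -exprMn.
Qed.

(* By the choice of the altitude, the slant height of the pyramid is
   2 (1 - eps) r. *)
Lemma area_density_pyramid_face c a i p : (a - c) ^+ 2 = b ^+ 2 ->
  area_density (patch_map (pyramid_face n r c a i)) p =
  (2 * h * r) * (2 * (1 - eps) * r).
Proof.
move=> ac; have h0 := half_angle_gt0 R hn.
have eps1 : 0 < 1 - eps by rewrite subr_gt0; case/andP: heps.
rewrite area_density_affine /cross_norm/=.
have [-> ->] := edgeE i; have p0 : 0 <= 2 * h * r.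
  by rewrite mulr_ge0 ?(ltW hr)// mulr_ge0 ?(ltW h0).
rewrite -[RHS]ger0_norm; last first.
  by rewrite mulr_ge0// !mulr_ge0 ?(ltW hr) ?(ltW eps1).
rewrite -sqrtr_sqr; congr Num.sqrt.
(* Pythagoras: the squared slant height minus the squared apothem. *)
have bE : b ^+ 2 = r ^+ 2 * (4 * (1 - eps) ^+ 2) - (r * (h / sin h) * cos h) ^+ 2.
  rewrite /altitude exprMn sqr_sqrtr ?(ltW hpyr)// /altitude_radicand /cot.
  rewrite mulrBr; congr (_ - _); rewrite -expr_div_n; ring.
have dc : cos (al i + h) * cos (al i) + sin (al i + h) * sin (al i) = cos h.
  by rewrite -cosB addrAC subrr add0r.
(* The edge is orthogonal to both the axis and the apothem, so the squared cross product is the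
   squared edge times the sum of (a - c) ^ 2 and the squared apothem. *)
transitivity ((2 * h * r) ^+ 2 * ((a - c) ^+ 2 *
  (cos (al i + h) ^+ 2 + sin (al i + h) ^+ 2) +
  (circumradius n r * (cos (al i + h) * cos (al i) + sin (al i + h) * sin (al i))) ^+ 2)).
  by ring.
rewrite cos2Dsin2 mulr1 dc ac bE circumradiusE// subrK; ring.
Qed.

End FaceDensities.

(** * Subdivision of plane sets along null lines *)

Section PlaneMeasure.
Variable R : realType.
Local Notation T := (measurableTypeR R).
Local Notation mu := (@lebesgue_measure R).
Local Notation mu2 := (mu \x mu)%E.
Local Open Scope ereal_scope.

(** Inversion is continuous only off 0, so the point 0, whose value is conventional, is split
    off. *)
Lemma measurable_inv_realType : measurable_fun setT (fun x : R => x^-1)%R.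
Proof.
rewrite -(setUv [set (0 : R)%R]); apply/measurable_funU => //.
  exact: measurableC.
split; first exact: measurable_fun_set1.
apply: open_continuous_measurable_fun.
  by rewrite openC; exact: closed_eq.
by move=> x; rewrite inE/= => /eqP x0; exact: inv_continuous.
Qed.

Lemma mu2_vertical (c : R) : mu2 ([set c] `*` setT) = 0.
Proof. rewrite product_measure1E// [X in X * _](_ : _ = 0) ?mul0e//.
exact: lebesgue_measure_set1. Qed.

Lemma mu2_horizontal (c : R) : mu2 (setT `*` [set c]) = 0.
Proof. rewrite product_measure1E// [X in _ * X](_ : _ = 0) ?mule0//.
exact: lebesgue_measure_set1. Qed.

(** Replacing Y by its part outside X changes it by a null set. This is how closed boxes with a
    common side are added. *)
Lemma measureU_negligibleI (X Y N : set (T * T)) : measurable X -> measurable Y ->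
  measurable N -> mu2 N = 0 -> X `&` Y `<=` N -> mu2 (X `|` Y) = mu2 X + mu2 Y.
Proof.
move=> mX mY mN N0 XYN; have mYX : measurable (Y `\` X) by exact: measurableD.
have -> : X `|` Y = X `|` (Y `\` X).
  apply/seteqP; split=> p /=; last by case=> [|[]]; [left|right].
  by move=> XYp; have [Xp|Xp] := pselect (X p); [left|right; case: XYp].
rewrite measureU//; last by rewrite setIDA setIC -setIDA setDv setI0.
have YX0 : mu2 (Y `&` X) = 0.
  apply: (@subset_measure0 _ _ _ mu2 _ N) => //; last by rewrite setIC.
  exact: measurableI.
have YE : mu2 Y = mu2 (Y `&` X) + mu2 (Y `\` X).
  rewrite -[in LHS](setUIDK Y X) measureU//; first exact: measurableI.
  by apply/seteqP; split=> // p [[_ Xp] []].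
by congr (_ + _); rewrite YE YX0 add0e.
Qed.

Lemma mu2_split_columns (E : set (T * T)) (J : set T) (a b c : R) :
  measurable E -> measurable J -> (a <= b <= c)%R ->
  mu2 (E `&` (`[a, c]%classic `*` J)) =
  mu2 (E `&` (`[a, b]%classic `*` J)) + mu2 (E `&` (`[b, c]%classic `*` J)).
Proof.
move=> mE mJ /andP[ab bc].
have -> : E `&` (`[a, c]%classic `*` J) =
    E `&` (`[a, b]%classic `*` J) `|` E `&` (`[b, c]%classic `*` J).
  apply/seteqP; split=> -[x y] /=; rewrite !in_itv/=.
    move=> [Exy [/andP[ax xc] Jy]]; have [xb|bx] := leP x b.
      by left; rewrite ax.
    by right; rewrite xc ltW.
  move=> [[Exy [/andP[ax xb] Jy]]|[Exy [/andP[bx xc] Jy]]].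
    by rewrite ax (le_trans xb bc).
  by rewrite xc (le_trans ab bx).
apply: (@measureU_negligibleI _ _ ([set b] `*` setT)).
- by apply: measurableI => //; apply: measurableX => //; exact: measurable_itv.
- by apply: measurableI => //; apply: measurableX => //; exact: measurable_itv.
- by apply: measurableX.
- exact: mu2_vertical.
- move=> [x y] /= [[_ [xab _]] [_ [xbc _]]]; split=> //.
  by move: xab xbc; rewrite !in_itv/= => /andP[_ xb] /andP[bx _]; apply: le_anti; rewrite xb.
Qed.

Lemma mu2_split_rows (E : set (T * T)) (I : set T) (a b c : R) :
  measurable E -> measurable I -> (a <= b <= c)%R ->
  mu2 (E `&` (I `*` `[a, c]%classic)) =
  mu2 (E `&` (I `*` `[a, b]%classic)) + mu2 (E `&` (I `*` `[b, c]%classic)).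
Proof.
move=> mE mI /andP[ab bc].
have -> : E `&` (I `*` `[a, c]%classic) =
    E `&` (I `*` `[a, b]%classic) `|` E `&` (I `*` `[b, c]%classic).
  apply/seteqP; split=> -[x y] /=; rewrite !in_itv/=.
    move=> [Exy [Iy /andP[ax xc]]]; have [xb|bx] := leP y b.
      by left; rewrite ax.
    by right; rewrite xc ltW.
  move=> [[Exy [Iy /andP[ax xb]]]|[Exy [Iy /andP[bx xc]]]].
    by rewrite ax (le_trans xb bc).
  by rewrite xc (le_trans ab bx).
apply: (@measureU_negligibleI _ _ (setT `*` [set b])).
- by apply: measurableI => //; apply: measurableX => //; exact: measurable_itv.
- by apply: measurableI => //; apply: measurableX => //; exact: measurable_itv.
- by apply: measurableX.
- exact: mu2_horizontal.
- move=> [x y] /= [[_ [_ xab]] [_ [_ xbc]]]; split=> //.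
  by move: xab xbc; rewrite !in_itv/= => /andP[_ xb] /andP[bx _]; apply: le_anti; rewrite xb.
Qed.

(** The parametrization of the sphere omits longitude 2 pi, which the union of the closed sectors
    contains. *)
Lemma mu2_half_open (E : set (T * T)) (J : set T) (a b : R) :
  measurable E -> measurable J -> (a <= b)%R ->
  mu2 (E `&` (`[a, b[%classic `*` J)) = mu2 (E `&` (`[a, b]%classic `*` J)).
Proof.
move=> mE mJ ab.
have -> : E `&` (`[a, b]%classic `*` J) =
    E `&` (`[a, b[%classic `*` J) `|` E `&` ([set b] `*` J).
  apply/seteqP; split=> -[x y] /=; rewrite !in_itv/=.
    move=> [Exy [/andP[ax xb] Jy]]; move: xb; rewrite le_eqVlt => /predU1P[xb|xb].
      by right; split.
    by left; rewrite ax.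
  move=> [[Exy [/andP[ax xb] Jy]]|[Exy [xb Jy]]]; first by rewrite ax ltW.
  by split=> //; split=> //; rewrite xb ab lexx.
rewrite (@measureU_negligibleI _ _ ([set b] `*` setT)).
- rewrite [X in _ = _ + X](_ : _ = 0) ?adde0//.
  apply: (@subset_measure0 _ _ _ mu2 _ ([set b] `*` setT)).
  + by apply: measurableI => //; exact: measurableX.
  + by apply: measurableX.
  + by move=> [x y] [_ [/= ? _]].
  + exact: mu2_vertical.
- by apply: measurableI => //; apply: measurableX => //; exact: measurable_itv.
- by apply: measurableI => //; apply: measurableX.
- by apply: measurableX.
- exact: mu2_vertical.
- by move=> [x y] [_ [_ [/= ? _]]].
Qed.

Lemma mu2_sum_columns (E : set (T * T)) (J : set T) (al : nat -> R) m :
  measurable E -> measurable J -> {homo al : i j / (i <= j)%N >-> (i <= j)%R} ->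
  \sum_(0 <= i < m) mu2 (E `&` (`[al i, al i.+1]%classic `*` J)) =
  mu2 (E `&` (`[al 0%N, al m]%classic `*` J)).
Proof.
move=> mE mJ hal; elim: m => [|m IH].
  (* With no column the interval degenerates to the point [al 0], and the set lies on a null
     vertical line. *)
  rewrite big_geq// set_itv1; apply/esym.
  apply: (@subset_measure0 _ _ _ mu2 _ ([set al 0%N] `*` setT)).
  - by apply: measurableI => //; exact: measurableX.
  - by apply: measurableX.
  - by move=> [x y] [_ [/= ? _]].
  - exact: mu2_vertical.
rewrite big_nat_recr; last by [].
rewrite IH; apply/esym; apply: mu2_split_columns; [by []|by []|].
by apply/andP; split; exact: hal.
Qed.

End PlaneMeasure.

Section Polynomials.
Variable R : realType.

Lemma is_derive_affine (c k x : R) :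
  is_derive x (1 : R) (fun u : R => c + k * u) k.
Proof.
apply: is_derive_eq
  (is_deriveD (is_derive_cst c x 1) (is_deriveZ k (is_derive_id x 1))) _.
by rewrite add0r; exact: mulr1.
Qed.

Lemma is_derive_quadratic (c k l x : R) :
  is_derive x (1 : R) (fun u : R => c + k * u + l * (u * u)) (k + 2 * l * x).
Proof.
apply: is_derive_eq (is_deriveD (is_derive_affine c k x)
  (is_deriveZ l (is_deriveM (is_derive_id x 1) (is_derive_id x 1)))) _.
by rewrite /= -![_ *: _]/(_ * _); ring.
Qed.

End Polynomials.

(** * Areas in the coordinates (longitude, height) *)

Section Areas.
Variables (R : realType) (n : nat) (r eps : R).
Hypotheses (hn : (3 <= n)%N) (hr : 0 < r) (heps : 0 <= eps < 1).
Hypothesis hpyr : 0 < altitude_radicand n eps.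
Local Notation T := (measurableTypeR R).
Local Notation mu := (@lebesgue_measure R).
Local Notation mu2 := (mu \x mu)%E.
Local Notation al := (alpha R n).
Local Notation b := (altitude n r eps).
Local Notation h := (pi / n%:R : R).
Local Notation face_pt := (face_pt n r eps).
Local Notation coords := (preimage (sphere_pt r)).
Local Notation box x y z w :=
  (`[x%R, y%R]%classic `*` `[z%R, w%R]%classic).

Let eps1 : 0 < 1 - eps. Proof. by rewrite subr_gt0; case/andP: heps. Qed.
Let er0 : 0 <= eps * r.
Proof. by rewrite mulr_ge0 ?(ltW hr)//; case/andP: heps. Qed.
Let er1 : eps * r <= r.
Proof. by rewrite ler_piMl ?(ltW hr)//; case/andP: heps => _ /ltW. Qed.
Let h0 : 0 < h. Proof. exact: half_angle_gt0. Qed.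
Let itv_lty (x y : R) : (mu `[x, y]%classic < +oo)%E.
Proof. by rewrite lebesgue_measure_itv/=; case: ifP => _; rewrite ?ltry. Qed.

Lemma measurable_coords (D : set (R * R * R)) : measurable D ->
  measurable (coords D : set (T * T)).
Proof.
move=> mD; suff mS : measurable_fun setT (sphere_pt r : T * T -> T * T * T).
  by rewrite -[X in measurable X]setTI; exact: mS.
have mf1 (f : R -> R) : continuous f -> measurable_fun setT (fun p : T * T => f p.1).
  move=> cf; apply: (measurableT_comp (continuous_measurable_fun cf)).
  exact: measurable_fst.
have mf2 (f : R -> R) : continuous f -> measurable_fun setT (fun p : T * T => f p.2).
  move=> cf; apply: (measurableT_comp (continuous_measurable_fun cf)).
  exact: measurable_snd.
apply: measurable_fun_pair; last exact: measurable_snd.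
apply: measurable_fun_pair; apply: measurable_funM.
- exact: mf2 (continuous_parallel_radius (r := r)).
- exact: mf1 (@continuous_cos R).
- exact: mf2 (continuous_parallel_radius (r := r)).
- exact: mf1 (@continuous_sin R).
Qed.

(** Injectivity of [T_map] lets its image of D be replaced by D itself, read in coordinates; so the
    measurability of D suffices, and that of the image is never at issue. *)
Lemma preimage_T_image (i : nat) (D : set (R * R * R)) (dom : set (R * R))
    (G : R * R -> R) (F : R -> R) (Phi : R * R -> R * R * R) :
  (i < n)%N -> D `<=` sphere r ->
  (forall p, dom p -> [/\ Phi p = face_pt i (G p, F p.2),
    al i <= G p <= al i.+1 & - r <= F p.2 <= r]) ->
  dom `&` Phi @^-1` (T_map n r eps @` D) =
  dom `&` (fun p => (G p, F p.2)) @^-1` coords D.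
Proof.
move=> ltin DS H; apply/seteqP; split=> p [dp] /=; have [Pp Gp Fp] := H p dp.
  move=> [q Dq Tq]; split=> //=.
  have -> : sphere_pt r (G p, F p.2) = q.
    apply: (T_map_inj hn hr heps hpyr).
    - exact: sphere_sphere_pt.
    - exact: DS.
    - by rewrite Tq Pp (T_map_sphere_pt hn hr heps ltin Gp Fp).
  by [].
move=> Dp; split=> //; exists (sphere_pt r (G p, F p.2)) => //.
by rewrite (T_map_sphere_pt hn hr heps ltin Gp Fp) Pp.
Qed.

(** Substitution on one slice of a face: s is the length of the slice in u, and k will be the
    angular width of the sector. *)
Lemma measure_affine_preimage (s a k : R) (A : set T) : 0 < s -> 0 < k ->
  measurable A ->
  ((k / s)%:E * mu (`[0%R, s]%classic `&` (fun u => a + k * (u / s))%R @^-1` A) =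
   mu (A `&` `[a, (a + k)%R]%classic))%E.
Proof.
move=> s0 k0 mA; have ks : 0 < k / s by rewrite divr_gt0.
pose F u := a + k * (u / s).
have dF (x : R) : is_derive x (1 : R) F (k / s).
  have -> : F = (fun u => a + k / s * u) by apply/funext => u; rewrite /F; ring.
  exact: is_derive_affine.
have cF : continuous F.
  by move=> x; apply/differentiable_continuous/derivable1_diffP; case: (dF x).
have mS : measurable (`[0, s] `&` F @^-1` A : set T).
  apply: measurableI; first exact: measurable_itv.
  by rewrite -[X in measurable X]setTI; exact: continuous_measurable_fun.
rewrite -integral_cst// -/F.
have := @integral_increasing_preimage R F (fun=> k / s) 0 s A (ltW s0) dF.
have -> : F 0 = a by rewrite /F mul0r mulr0 addr0.
have -> : F s = a + k by rewrite /F divff ?gt_eqF// mulr1.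
apply.
- by move=> x; exact: cvg_cst.
- by move=> x _; exact: ltW.
- by move=> x y _ _; rewrite lerD2l ler_pM2l// ler_pM2r// invr_gt0.
- by [].
Qed.

(** Leaving the height function F open covers both pyramids. The slice at v has length 1 - v, and
    the factor (1 - v) / (2 h) turns the constant density into r times
    [2 * r * (1 - eps) * (1 - v)], the speed of the height, which the last hypothesis integrates. *)
Lemma pyramid_face_area (c a : R) (i : nat) (F : R -> R) (J : set R)
    (D : set (R * R * R)) :
  (i < n)%N -> (a - c) ^+ 2 = b ^+ 2 -> measurable D -> D `<=` sphere r ->
  (forall s u, 0 <= s <= 1 -> patch_map (pyramid_face n r c a i) (s * u, 1 - s) =
    face_pt i (al i + 2 * h * u, F (1 - s))) ->
  (forall v, 0 <= v <= 1 -> - r <= F v <= r) -> continuous F ->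
  measurable (J : set T) -> (mu J < +oo)%E ->
  (forall B : set R, measurable B ->
    \int[mu]_(v in `[0%R, 1%R]%classic `&` F @^-1` B) (2 * r * (1 - eps) * (1 - v))%:E =
    mu (B `&` J))%E ->
  (\int[mu2]_(p in patch_dom (pyramid_face n r c a i) `&`
       patch_map (pyramid_face n r c a i) @^-1` (T_map n r eps @` D))
     (area_density (patch_map (pyramid_face n r c a i)) p)%:E =
   r%:E * mu2 (coords D `&` (`[al i, al i.+1]%classic `*` J)))%E.
Proof.
move=> ltin ac mD DS FE Fb cF mJ Joo outer.
pose G (p : R * R) := al i + 2 * h * (p.1 / (1 - p.2)).
have h2 : 0 < 2 * h by rewrite mulr_gt0.
rewrite (@preimage_T_image i D _ G F)//; last first.
  move=> p /triangle_param[pE sb ub].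
  split; [|exact: sector_scale_bounds|].
  - by rewrite [in LHS]pE FE// /G; congr (face_pt i (_, F _)); lra.
  - by apply: Fb; move: sb; lra.
pose g := 2 * h * r * (2 * (1 - eps) * r).
under eq_integral do rewrite (area_density_pyramid_face hn hr heps hpyr) //.
have mid : measurable_fun setT (fun v : T => 1 - v) by apply: measurable_funB.
apply: (@integral_skew_preimage R _ G F (fun=> g)
  (fun v => 2 * r * (1 - eps) * (1 - v)) 0 1 r) => //.
- have -> : patch_dom (pyramid_face n r c a i) =
      ((fst @^-1` `[0, +oo[) `&` (snd @^-1` `[0, +oo[)) `&`
      (fun p : T * T => p.1 + p.2) @^-1` `]-oo, 1].
    apply/seteqP; split=> p /=; rewrite !in_itv/= !andbT; first by case.
    by move=> [[? ?] ?].
  have mpre (f : T * T -> T) (A : set T) : measurable_fun setT f -> measurable A ->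
      measurable (f @^-1` A).
    by move=> mf mA; rewrite -[X in measurable X]setTI; exact: mf.
  apply: measurableI; first apply: measurableI.
  + by apply: mpre; [exact: measurable_fst|exact: measurable_itv].
  + by apply: mpre; [exact: measurable_snd|exact: measurable_itv].
  + apply: mpre; last exact: measurable_itv.
    by apply: measurable_funD; [exact: measurable_fst|exact: measurable_snd].
- apply: measurable_funD => //; apply: measurable_funM => //.
  apply: measurable_funM; first exact: measurable_fst.
  apply: (measurableT_comp (@measurable_inv_realType R)).
  exact: (measurableT_comp mid (@measurable_snd _ _ T T)).
- exact: continuous_measurable_fun.
- by apply: measurable_funM.
- move=> p _; apply: mulr_ge0; first by apply: mulr_ge0; exact: ltW.
  by rewrite !mulr_ge0 ?(ltW hr) ?(ltW eps1).
- by move=> p [? ? ?]; rewrite in_itv/=; apply/andP; split; lra.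
- move=> v; rewrite in_itv/= => /andP[_ v1].
  by rewrite !mulr_ge0 ?(ltW hr) ?(ltW eps1)// subr_ge0.
- exact: ltW.
- move=> v A; rewrite in_itv/= => /andP[v0 v1] mA.
  (* At the apex level the slice is contained in {0}, so both sides are 0. *)
  have [v1'|v1'] := eqVneq (1 - v) 0.
    rewrite v1' !mulr0 mul0e.
    rewrite [X in (_ * X)%E](_ : _ = 0%E) ?mule0//.
    have /subset_set1[->|->] : [set u | patch_dom (pyramid_face n r c a i) (u, v) /\
        A (G (u, v))] `<=` [set 0].
    - by move=> u [[/= u0 _ uv] _]; apply: le_anti; rewrite u0 andbT; lra.
    - exact: measure0.
    - exact: lebesgue_measure_set1.
  have s0 : 0 < 1 - v by rewrite lt_neqAle eq_sym v1' subr_ge0.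
  rewrite alphaS// -(measure_affine_preimage (al i) s0 h2 mA).
  rewrite muleA -EFinM /g; congr (_%:E * mu _)%E.
    by move: (pi / n%:R) => x; field.
  apply/seteqP; split=> u /=; rewrite in_itv/=.
    by move=> [[? ? ?] ?]; split=> //; apply/andP; split=> //; lra.
  by move=> [/andP[? ?] ?]; split=> //; split=> //; lra.
- exact: measurable_coords.
Qed.

Lemma prism_face_area (i : nat) (D : set (R * R * R)) :
  (i < n)%N -> measurable D -> D `<=` sphere r ->
  (\int[mu2]_(p in patch_dom (prism_face n r eps i) `&`
       patch_map (prism_face n r eps i) @^-1` (T_map n r eps @` D))
     (area_density (patch_map (prism_face n r eps i)) p)%:E =
   r%:E * mu2 (coords D `&`
     box (al i) (al i.+1) (- (eps * r)) (eps * r)))%E.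
Proof.
move=> ltin mD DS.
pose G (p : R * R) := al i + 2 * h * p.1.
pose F (v : R) := eps * r * (2 * v - 1).
have h2 : 0 < 2 * h by rewrite mulr_gt0.
have mE := measurable_coords mD.
rewrite (@preimage_T_image i D _ G F)//; last first.
  move=> [u v] [ub vb]; split; [exact: prism_face_map|exact: sector_scale_bounds|].
  have /andP[v0 v1] := vb.
  have := mulr_ge0 er0 v0; have := ler_wpM2l er0 v1.
  by rewrite /F/= => ? ?; apply/andP; split; move: er1; lra.
pose g := 2 * h * r * (2 * (eps * r)).
under eq_integral do rewrite (area_density_prism_face hn hr heps) //.
(* For [eps = 0] the density vanishes and the box is a horizontal segment, so both sides are 0. *)
have [e00|en0] := eqVneq (eps * r) 0.
  rewrite e00 !mulr0 integral0 oppr0 set_itv1.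
  rewrite [X in (_ * X)%E](_ : _ = 0%E) ?mule0//.
  apply: (@subset_measure0 _ _ _ mu2 _ (setT `*` [set (0 : R)])).
  - by apply: measurableI => //; apply: measurableX => //; exact: measurable_itv.
  - by apply: measurableX.
  - by move=> [x y] [_ [_ ?]].
  - exact: mu2_horizontal.
have ep : 0 < eps * r by rewrite lt_neqAle eq_sym en0.
have FE : F = (fun v => - (eps * r) + 2 * (eps * r) * v).
  by apply/funext => v; rewrite /F; ring.
have dF (x : R) : is_derive x (1 : R) F (2 * (eps * r)).
  by rewrite FE; exact: is_derive_affine.
have cF : continuous F.
  by move=> x; apply/differentiable_continuous/derivable1_diffP; case: (dF x).
have mpre (f : T * T -> T) (A : set T) : measurable_fun setT f -> measurable A ->
    measurable (f @^-1` A).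
  by move=> mf mA; rewrite -[X in measurable X]setTI; exact: mf.
apply: (@integral_skew_preimage R _ G F (fun=> g) (fun=> 2 * (eps * r)) 0 1 r) => //.
- have -> : patch_dom (prism_face n r eps i) =
      (fst @^-1` `[0, 1]) `&` (snd @^-1` `[0, 1]).
    by apply/seteqP; split=> p /=; rewrite !in_itv/=.
  apply: measurableI.
  + by apply: mpre; [exact: measurable_fst|exact: measurable_itv].
  + by apply: mpre; [exact: measurable_snd|exact: measurable_itv].
- by apply: measurable_funD => //; apply: measurable_funM.
- exact: continuous_measurable_fun.
- move=> p _; apply: mulr_ge0; first by apply: mulr_ge0; exact: ltW.
  by rewrite mulr_ge0.
- by move=> p [_ ?]; rewrite in_itv.
- by move=> v _; rewrite mulr_ge0.
- exact: ltW.
- move=> v A; rewrite in_itv/= => vb mA.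
  rewrite alphaS// -(measure_affine_preimage (al i) ltr01 h2 mA).
  rewrite muleA -EFinM /g; congr (_%:E * mu _)%E; first by rewrite divr1; ring.
  apply/seteqP; split=> u /=; rewrite in_itv/= divr1.
    by move=> [[]].
  by move=> [].
- move=> B mB; rewrite (@integral_increasing_preimage R F (fun=> 2 * (eps * r)) 0 1)//.
  + have -> : F 0 = - (eps * r) by rewrite /F; ring.
    by have -> : F 1 = eps * r by rewrite /F; ring.
  + by move=> x; exact: cvg_cst.
  + by move=> x _; rewrite mulr_ge0.
  + by move=> x y _ _; rewrite FE lerD2l ler_pM2l// mulr_gt0.
Qed.

Lemma cap_height_quadratic : (fun v => r - r * (1 - eps) * (1 - v) ^+ 2) =
  (fun v : R => eps * r + 2 * r * (1 - eps) * v + - (r * (1 - eps)) * (v * v)).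
Proof. by apply/funext => v; ring. Qed.

(** The derivative of [cap_height], which is z as a function of the triangle parameter v = 1 - s. *)
Let cap_rate (v : R) := 2 * r * (1 - eps) * (1 - v).

Let cap_height (v : R) := r - r * (1 - eps) * (1 - v) ^+ 2.

Let is_derive_cap_height (x : R) : is_derive x (1 : R) cap_height (cap_rate x).
Proof.
rewrite /cap_height cap_height_quadratic.
by apply: is_derive_eq (is_derive_quadratic _ _ _ _) _; rewrite /cap_rate; ring.
Qed.

Let continuous_cap_height : continuous cap_height.
Proof.
move=> x; apply/differentiable_continuous/derivable1_diffP.
by case: (is_derive_cap_height x).
Qed.

Let continuous_cap_rate : continuous cap_rate.
Proof.
move=> x; apply: cvgM; first exact: cvg_cst.
by apply: cvgB; [exact: cvg_cst|exact: cvg_id].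
Qed.

Let cap_rate_ge0 : {in `[0, 1], forall v, 0 <= cap_rate v}.
Proof.
move=> v; rewrite in_itv/= => /andP[_ v1].
by rewrite /cap_rate !mulr_ge0 ?(ltW hr) ?(ltW eps1)// subr_ge0.
Qed.

Let cap_height_mono : {in `[0, 1] &, {mono cap_height : x y / x <= y}}.
Proof.
move=> x y; rewrite !in_itv/= => /andP[x0 x1] /andP[y0 y1].
rewrite /cap_height lerD2l lerN2 ler_pM2l ?mulr_gt0//.
by rewrite ler_pXn2r ?nnegrE ?subr_ge0// lerD2l lerN2.
Qed.

Let cap_height0 : cap_height 0 = eps * r.
Proof. by rewrite /cap_height; ring. Qed.

Let cap_height1 : cap_height 1 = r.
Proof. by rewrite /cap_height; ring. Qed.

Let cap_height_bounds (v : R) : 0 <= v <= 1 -> eps * r <= cap_height v <= r.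
Proof. by move=> vb; apply: cap_bounds => //; lra. Qed.

Lemma upper_face_area (i : nat) (D : set (R * R * R)) :
  (i < n)%N -> measurable D -> D `<=` sphere r ->
  let S := pyramid_face n r (eps * r) (eps * r + b) i in
  (\int[mu2]_(p in patch_dom S `&` patch_map S @^-1` (T_map n r eps @` D))
     (area_density (patch_map S) p)%:E =
   r%:E * mu2 (coords D `&` box (al i) (al i.+1) (eps * r) r))%E.
Proof.
move=> ltin mD DS /=; apply: (@pyramid_face_area _ _ _ cap_height) => //.
- by rewrite addrC addKr.
- by move=> s u sb; rewrite /cap_height subKr; exact: upper_face_map.
- by move=> v /cap_height_bounds; move: er0; lra.
- move=> B mB; have := integral_increasing_preimage ler01 is_derive_cap_height
    continuous_cap_rate cap_rate_ge0 cap_height_mono mB.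
  by rewrite cap_height0 cap_height1.
Qed.

Lemma lower_face_area (i : nat) (D : set (R * R * R)) :
  (i < n)%N -> measurable D -> D `<=` sphere r ->
  let S := pyramid_face n r (- (eps * r)) (- (eps * r + b)) i in
  (\int[mu2]_(p in patch_dom S `&` patch_map S @^-1` (T_map n r eps @` D))
     (area_density (patch_map S) p)%:E =
   r%:E * mu2 (coords D `&`
     box (al i) (al i.+1) (- r) (- (eps * r))))%E.
Proof.
move=> ltin mD DS /=.
have dN (x : R) : is_derive x (1 : R) (fun v => - cap_height v) (- cap_rate x).
  exact: is_deriveN.
apply: (@pyramid_face_area _ _ _ (fun v => - cap_height v)) => //.
- by rewrite opprK; ring.
- by move=> s u sb; rewrite /cap_height subKr; exact: lower_face_map.
- by move=> v /cap_height_bounds; move: er0; lra.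
- by move=> x; apply: cvgN; exact: continuous_cap_height.
- have monoN : {in `[0, 1] &, {mono (fun v => - cap_height v) : x y /~ x <= y}}.
    by move=> x y xb yb; rewrite lerN2 cap_height_mono.
  move=> B mB; have := integral_decreasing_preimage ler01 dN
    continuous_cap_rate cap_rate_ge0 monoN mB.
  by rewrite cap_height0 cap_height1.
Qed.

(** The height z = r cos v decreases at speed r sin v, which leaves one factor r from the density r
    ^ 2 sin v. *)
Lemma sphere_areaE (D : set (R * R * R)) : measurable D ->
  (sphere_area r D =
   r%:E * mu2 (coords D `&` box 0 (2 * pi) (- r) r))%E.
Proof.
move=> mD; rewrite /sphere_area /surface_area big_seq1.
have pi0 := pi_gt0 R; have mE := measurable_coords mD.
have mJ : measurable (`[- r, r]%classic : set T) by exact: measurable_itv.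
rewrite -mu2_half_open//; last by lra.
pose F (v : R) := r * cos v.
have dF (x : R) : is_derive x (1 : R) F (- (r * sin x)).
  have -> : F = r *: (@cos R) by apply/funext.
  by apply: is_derive_eq; rewrite scalerN.
have cF : continuous F.
  by move=> x; apply: cvgM; [exact: cvg_cst|exact: continuous_cos].
have cs : continuous (fun x : R => r * sin x).
  by move=> x; apply: cvgM; [exact: cvg_cst|exact: continuous_sin].
have cg : continuous (fun x : R => r ^+ 2 * sin x).
  by move=> x; apply: cvgM; [exact: cvg_cst|exact: continuous_sin].
have -> : patch_dom (sphere_patch r) `&` patch_map (sphere_patch r) @^-1` D =
    patch_dom (sphere_patch r) `&` (fun p => (p.1, F p.2)) @^-1` coords D.
  have pt p : patch_dom (sphere_patch r) p ->
      patch_map (sphere_patch r) p = sphere_pt r (p.1, F p.2).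
    move=> [_ pb]; rewrite /sphere_pt/= /F.
    have -> : r ^+ 2 - (r * cos p.2) ^+ 2 = (r * sin p.2) ^+ 2.
      by rewrite !exprMn -[X in X - _]mulr1 -(cos2Dsin2 p.2); ring.
    rewrite sqrtr_sqr ger0_norm ?mulr_ge0 ?(ltW hr) ?sin_ge0_pi//.
    by congr (_, _, _); ring.
  apply/seteqP; split=> p [dp Dp]; split=> //.
    by change (D (sphere_pt r (p.1, F p.2))); rewrite -pt.
  by change (D (patch_map (sphere_patch r) p)); rewrite pt.
transitivity (\int[mu2]_(p in patch_dom (sphere_patch r) `&`
    (fun p => (p.1, F p.2)) @^-1` coords D) (r ^+ 2 * sin p.2)%:E)%E.
  apply: eq_integral => p /set_mem[[_ pb] _].
  by rewrite (area_density_sphere hr pb).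
have mpre (f : T * T -> T) (A : set T) : measurable_fun setT f -> measurable A ->
    measurable (f @^-1` A).
  by move=> mf mA; rewrite -[X in measurable X]setTI; exact: mf.
apply: (@integral_skew_preimage R _ fst F (fun v => r ^+ 2 * sin v)
  (fun v => r * sin v) 0 pi r) => //.
- have -> : patch_dom (sphere_patch r) =
      (fst @^-1` `[0, 2 * pi[) `&` (snd @^-1` `[0, pi]).
    by apply/seteqP; split=> p /=; rewrite !in_itv/=.
  apply: measurableI.
  + by apply: mpre; [exact: measurable_fst|exact: measurable_itv].
  + by apply: mpre; [exact: measurable_snd|exact: measurable_itv].
- exact: continuous_measurable_fun.
- exact: continuous_measurable_fun.
- exact: continuous_measurable_fun.
- by move=> p [_ pb]; rewrite mulr_ge0 ?sqr_ge0// sin_ge0_pi.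
- by move=> p [_ ?]; rewrite in_itv.
- by move=> v; rewrite in_itv/= => vb; rewrite mulr_ge0 ?(ltW hr)// sin_ge0_pi.
- by rewrite lebesgue_measure_itv/=; case: ifP => _; rewrite ?ltry.
- exact: ltW.
- move=> v A; rewrite in_itv/= => vb mA.
  congr (_%:E * mu _)%E; first by ring.
  apply/seteqP; split=> u /=; rewrite in_itv/=; first by move=> [[]].
  by move=> [].
- move=> B mB; rewrite (@integral_decreasing_preimage R F (fun x => r * sin x) 0 pi) ?ltW//.
  + by rewrite /F cos0 cospi mulrN !mulr1.
  + by move=> v; rewrite in_itv/= => vb; rewrite mulr_ge0 ?(ltW hr)// sin_ge0_pi.
  + by move=> x y xb yb; rewrite /F ler_pM2l// leNgt ltr_cos// -leNgt.
Qed.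

(** The coordinate boxes of the faces tile [0, 2 pi] x [- r, r] up to null lines: the sectors add up
    to full rows, then the three zones of z add up to the rectangle. *)
Lemma T_map_area (D : set (R * R * R)) : measurable D -> D `<=` sphere r ->
  sphere_area r D = polyhedron_area n r eps (T_map n r eps @` D).
Proof.
move=> mD DS; rewrite sphere_areaE// /polyhedron_area /surface_area !big_cat/=.
have mE := measurable_coords mD.
have hal : {homo al : i j / (i <= j)%N >-> (i <= j)%R} by move=> i j; exact: ler_alpha.
have col J : measurable (J : set T) ->
    (\sum_(i <- iota 0 n) r%:E * mu2 (coords D `&` (`[al i, al i.+1]%classic `*` J)) =
     r%:E * mu2 (coords D `&` (`[0%R, (2 * pi)%R]%classic `*` J)))%E.
  move=> mJ; rewrite -(alphan R hn) -(alpha0 R n) -mu2_sum_columns//.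
  by rewrite ge0_sume_distrr// /index_iota subn0.
have itvm (x y : R) : measurable (`[x, y]%classic : set T) by exact: measurable_itv.
rewrite /prism_faces /upper_faces /lower_faces /pyramid_faces !big_map.
rewrite [X in (_ = X + _)%E](_ : _ = r%:E * mu2 (coords D `&`
  box 0 (2 * pi) (- (eps * r)) (eps * r)))%E; last first.
  rewrite -col// big_seq [RHS]big_seq; apply: eq_bigr => i.
  by rewrite mem_iota => /andP[_ ltin]; exact: prism_face_area.
rewrite [X in (_ = _ + (X + _))%E](_ : _ = r%:E * mu2 (coords D `&`
  box 0 (2 * pi) (eps * r) r))%E; last first.
  rewrite -col// big_seq [RHS]big_seq; apply: eq_bigr => i.
  by rewrite mem_iota => /andP[_ ltin]; exact: upper_face_area.
rewrite [X in (_ = _ + (_ + X))%E](_ : _ = r%:E * mu2 (coords D `&`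
  box 0 (2 * pi) (- r) (- (eps * r))))%E; last first.
  rewrite -col// big_seq [RHS]big_seq; apply: eq_bigr => i.
  by rewrite mem_iota => /andP[_ ltin]; exact: lower_face_area.
rewrite (@mu2_split_rows _ _ _ (- r) (- (eps * r)) r)//; last first.
  by apply/andP; split; move: er0 er1; lra.
rewrite (@mu2_split_rows _ _ _ (- (eps * r)) (eps * r) r)//; last first.
  by apply/andP; split; move: er0 er1; lra.
(* Nonnegativity gives distributivity in the extended reals; the zones, cut from bottom to top, are
   reordered as in the list of faces. *)
have sum3 (c x y z : \bar R) : (0 <= x)%E -> (0 <= y)%E -> (0 <= z)%E ->
    (c * (x + (y + z)) = c * y + (c * z + c * x))%E.
  by move=> x0 y0 z0; rewrite !ge0_muleDr ?adde_ge0// [LHS]addeC -addeA.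
by apply: sum3; exact: measure_ge0.
Qed.

End Areas.

Theorem mainTheorem1 (R : realType) (n : nat) (r eps : R)
    (hn : (3 <= n)%N) (hr : 0 < r) (heps : 0 <= eps < 1)
    (hpyr : 0 < altitude_radicand n eps) :
  [/\ {within sphere r, continuous (T_map n r eps)},
      set_bij (sphere r) (polyhedron n r eps) (T_map n r eps),
      forall D : set (R * R * R), measurable D -> D `<=` sphere r ->
        sphere_area r D = polyhedron_area n r eps (T_map n r eps @` D)
    & forall (X Y Z x y z : R) (i : nat),
        polyhedron n r eps (X, Y, Z) -> (i < n)%N ->
        (exists2 t : R, alpha R n i <= t <= alpha R n i.+1
                      & polar_angle X Y t) ->
        sphere r (x, y, z) -> T_map n r eps (x, y, z) = (X, Y, Z) ->
        let a := alpha R n i in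
        let b := altitude n r eps in
        let lam := pi / (n%:R * sin (pi / n%:R)) *
            ((- X * sin a + Y * cos a) /
             (X * cos (a + pi / n%:R) + Y * sin (a + pi / n%:R))) in
        let mu := (Y * cos a - X * sin a) / (r * cos (pi / n%:R)) in
        [/\ upper_pyramid n r eps (X, Y, Z) ->
              z = r - r * (1 - eps) * (1 - (Z - eps * r) / b) ^+ 2,
            lower_pyramid n r eps (X, Y, Z) ->
              z = r * (1 - eps) * (1 - (`|Z| - eps * r) / b) ^+ 2 - r,
            upper_pyramid n r eps (X, Y, Z) \/ lower_pyramid n r eps (X, Y, Z) ->
              if (X == 0) && (Y == 0) then x = 0 /\ y = 0
              else x = Num.sqrt (r ^+ 2 - z ^+ 2) * cos (lam + a) /\
                   y = Num.sqrt (r ^+ 2 - z ^+ 2) * sin (lam + a)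
          & prism n r eps (X, Y, Z) ->
              [/\ z = Z,
                  x = Num.sqrt (r ^+ 2 - Z ^+ 2) * cos (mu + a)
                & y = Num.sqrt (r ^+ 2 - Z ^+ 2) * sin (mu + a)]]].
Proof.
split; [exact: T_map_continuous|exact: T_map_bij|exact: T_map_area|].
exact: T_map_inverse.
Qed.
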